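(* Let $p\ge 1$ be an integer or $p=\infty$. If $p\geq 1$ is finite, assume that the data-generating distribution $\mathbf{P}$ satisfies the light-tailed assumption; if $p=\infty$, assume the regularity assumption on $(S,\mathbf{P})$ (both stated in the context). Let $\beta\in(0,1)$, let $\epsilon_N(\beta)$ be the radius defined in the context, and let $\eta_N(K)$ be the average $p$-th powered distance of the data points in $\mathcal{D}_N$ from their assigned cluster centers, i.e. $\eta_N(K)=\frac1N\sum_{k=1}^K\sum_{i\in C_k}\|d_i-\bar d_k\|^p$ (with $\eta_N(K)^{1/p}$ read as $\max_{k}\max_{i\in C_k}\|d_i-\bar d_k\|$ when $p=\infty$). If $\hat x_N$ is an optimal solution of the mean robust optimization problem (MRO) with uncertainty set $\mathcal{U}(K,\epsilon_N(\beta)+\eta_N(K)^{1/p})$, then the finite sample guarantee $$\mathbf{P}^N\left(\mathbf{E}^{\mathbf{P}}\left(g(u,\hat x_N)\right)\le 0\right)\ge 1-\beta$$ holds.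
   Context: Setting. $\mathcal{X}\subseteq\mathbf{R}^n$ is compact, $f$ is an objective function on $\mathcal X$, and $S\subseteq\mathbf{R}^m$ is convex and closed. The constraint function is $g(u,x)=\max_{j\le J}g_j(u,x)$ with $J\geq 1$ (the case $J=1$ is that of a single concave function), where for each $j$ and all $x$ the function $u\mapsto -g_j(u,x)$ is proper, convex and lower-semicontinuous. The domain $\operatorname{dom}_u g_j$ in $u$ does not depend on $x$ and contains $S$; moreover either this domain is $\mathbf{R}^m$, or $g_j$ is element-wise monotonically increasing in $u$ and its domain is only (potentially) bounded from below, or $g_j$ is element-wise monotonically decreasing in $u$ and its domain is only (potentially) bounded from above. Data and clusters. $u$ is a random vector with unknown distribution $\mathbf{P}$ supported on $S$; $\mathcal{D}_N=\{d_i\}_{i\le N}\subseteq S$ are $N$ independent samples of $u$, governed by the product distribution $\mathbf{P}^N$. The data set is partitioned into $K$ disjoint nonempty clusters with index sets $C_1,\dots,C_K$; $\bar d_k=\frac{1}{|C_k|}\sum_{i\in C_k}d_i$ is the centroid and $w_k=|C_k|/N$ the weight of the $k$-th cluster. $\|\cdot\|$ is a norm on $\mathbf{R}^m$. MRO problem. Let $\Gamma=\{\alpha\mid \sum_{j=1}^J\alpha_{jk}=w_k,\ \alpha_{jk}\ge 0\ \forall k,j\}$. The problem (MRO) with uncertainty set $\mathcal{U}(K,\epsilon)$ is: minimize $f(x)$ over $x\in\mathcal X$ subject to $$\sum_{k=1}^K\sum_{j=1}^J\alpha_{jk}\,g_j(v_{jk},x)\le 0$$ for all $\alpha\in\Gamma$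 and all $(v_{11},\dots,v_{JK})$ with every $v_{jk}\in S$ such that - if $p<\infty$: $\sum_{k=1}^K\sum_{j=1}^J\alpha_{jk}\|v_{jk}-\bar d_k\|^p\le\epsilon^p$; - if $p=\infty$: $\max_{k=1,\dots,K}\sum_{j=1}^J(\alpha_{jk}/w_k)\|v_{jk}-\bar d_k\|\le\epsilon$. For $J=1$ this reads $\sum_k w_k g(v_k,x)\le 0$ for all $v_1,\dots,v_K\in S$ with $\sum_k w_k\|v_k-\bar d_k\|^p\le\epsilon^p$ (respectively $\max_k\|v_k-\bar d_k\|\le\epsilon$). Wasserstein distance. $W_p(\mathbf{Q},\mathbf{Q}')=\inf_\Pi\left(\int\|u-u'\|^p\,\Pi(du,du')\right)^{1/p}$ over joint distributions $\Pi$ with marginals $\mathbf{Q},\mathbf{Q}'$, and $W_\infty$ is the usual $\infty$-Wasserstein distance (infimum over $\Pi$ of the $\Pi$-essential supremum of $\|u-u'\|$). $\hat{\mathbf{P}}^N=\frac1N\sum_{i=1}^N\delta_{d_i}$ is the empirical distribution. Light-tailed assumption ($p$ finite): there exist $a>0$ and $t>0$ such that $\mathbf{E}^{\mathbf{P}}(\exp(t\|u\|^a))<\infty$. Regularity assumption ($p=\infty$): the interior of $S$ is a bounded, connected, open set with Lipschitz boundary, and $\mathbf{P}$ has a density $\rho$ on it for which there is $\lambda\ge1$ with $1/\lambda\le\rho(x)\le\lambda$ for all $x$. Radius $\epsilon_N(\beta)$. Under these assumptions, known measure concentration theorems (which may be taken as given) provide a function $\phi$ (exponentially decaying in $N$)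 such that $\mathbf{P}^N(W_p(\mathbf{P},\hat{\mathbf{P}}^N)\ge\epsilon)\le\phi(p,N,\epsilon)$. The radius $\epsilon_N(\beta)>0$ is the solution $\epsilon$ of $\phi(p,N,\epsilon)=\beta$; in particular $\mathbf{P}^N(W_p(\mathbf{P},\hat{\mathbf{P}}^N)\ge\epsilon_N(\beta))\le\beta$. *)

(* Defs.v *)
From HB Require Import structures.
From mathcomp Require Import all_boot all_order all_algebra.
From mathcomp Require Import all_classical all_reals all_analysis.

Set Implicit Arguments.
Unset Strict Implicit.
Unset Printing Implicit Defensive.

Import Order.TTheory GRing.Theory Num.Theory.
Import numFieldNormedType.Exports.

Local Open Scope classical_set_scope.
Local Open Scope ring_scope.

(* The topology on ['rV[R]_m] is the library's, induced by the sup norm; all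
   norms on ['rV[R]_m] induce it. [nrm] below is the norm of the problem. *)
Definition is_norm (R : realType) (m : nat) (nrm : 'rV[R]_m -> R) : Prop :=
  [/\ forall u, nrm u = 0 -> u = 0,
      forall (a : R) u, nrm (a *: u) = `|a| * nrm u
    & forall u v, nrm (u + v) <= nrm u + nrm v].

Definition rV_le (R : realType) (m : nat) (u v : 'rV[R]_m) : Prop :=
  forall i, u ord0 i <= v ord0 i.

Definition dotp (R : realType) (m : nat) (u v : 'rV[R]_m) : R :=
  \sum_i u ord0 i * v ord0 i.

Definition proper_fun (R : realType) (m : nat) (h : 'rV[R]_m -> \bar R) : Prop :=
  (forall u, -oo < h u)%E /\ (exists u, h u < +oo)%E.

(* Convexity of extended-real-valued functions. It is only used for functions
   that never take the value [-oo], so that no [+oo - oo] arises; at the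
   endpoints, [0 * +oo = 0]. *)
Definition econvex_fun (R : realType) (m : nat) (h : 'rV[R]_m -> \bar R) : Prop :=
  forall (t : R) (u v : 'rV[R]_m), 0 <= t <= 1 ->
    (h (t *: u + (1 - t) *: v)%R <= t%:E * h u + (1 - t)%:E * h v)%E.

(* [h u x] is an extended-real-valued function, concave in [u]; its domain in
   [u] is where it is not [-oo]. *)
Definition dom_u (R : realType) (m n : nat)
    (h : 'rV[R]_m -> 'rV[R]_n -> \bar R) (x : 'rV[R]_n) : set 'rV[R]_m :=
  [set u | (-oo < h u x)%E].

(* A domain that is only (potentially) bounded from below is one that places no
   upper restriction on [u], i.e. an upward closed set for the element-wise
   order; dually for domains only (potentially) bounded from above. *)
Definition domain_condition (R : realType) (m n : nat)
    (X : set 'rV[R]_n) (S : set 'rV[R]_m)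
    (h : 'rV[R]_m -> 'rV[R]_n -> \bar R) : Prop :=
  exists D : set 'rV[R]_m,
    [/\ forall x, X x -> dom_u h x = D,
        S `<=` D
      & [\/ D = setT,
            (forall x u v, X x -> D u -> D v -> rV_le u v -> (h u x <= h v x)%E)
            /\ (forall u v, D u -> rV_le u v -> D v)
          | (forall x u v, X x -> D u -> D v -> rV_le u v -> (h v x <= h u x)%E)
            /\ (forall u v, D v -> rV_le u v -> D u)]].

Definition constraint_condition (R : realType) (m n J : nat)
    (X : set 'rV[R]_n) (S : set 'rV[R]_m)
    (g : 'I_J -> 'rV[R]_m -> 'rV[R]_n -> \bar R) : Prop :=
  forall j,
    (forall x, X x ->
      [/\ proper_fun (fun u => - g j u x)%E,
          econvex_fun (fun u => - g j u x)%E
        & lower_semicontinuous (fun u => - g j u x)%E])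
    /\ domain_condition X S (g j).

Definition gmax (R : realType) (m n J : nat)
    (g : 'I_J -> 'rV[R]_m -> 'rV[R]_n -> \bar R)
    (u : 'rV[R]_m) (x : 'rV[R]_n) : \bar R :=
  \big[maxe/-oo%E]_(j < J) g j u x.

Definition borelRV (R : realType) (m : nat) :=
  g_sigma_algebraType (@open 'rV[R]_m).

(* Inner and outer probability: no measurability has to be required of the
   events considered (the clusters and the decision are arbitrary functions of
   the data). Both agree with [P] on measurable sets. *)
Definition inner_prob d (T : measurableType d) (R : realType)
    (P : probability T R) (A : set T) : \bar R :=
  ereal_sup [set P B | B in [set B | measurable B /\ B `<=` A]].

Definition outer_prob d (T : measurableType d) (R : realType)
    (P : probability T R) (A : set T) : \bar R :=
  ereal_inf [set P B | B in [set B | measurable B /\ A `<=` B]].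

Lemma inner_prob_measurable d (T : measurableType d) (R : realType)
    (P : probability T R) (A : set T) :
  measurable A -> inner_prob P A = P A.
Proof.
move=> mA; apply/eqP; rewrite eq_le; apply/andP; split.
- apply: ge_ereal_sup => _ [B [mB BA] <-].
  by apply: le_measure => //; rewrite inE.
- by apply: ereal_sup_ubound; exists A => //; split.
Qed.

Lemma outer_prob_measurable d (T : measurableType d) (R : realType)
    (P : probability T R) (A : set T) :
  measurable A -> outer_prob P A = P A.
Proof.
move=> mA; apply/eqP; rewrite eq_le; apply/andP; split.
- by apply: ereal_inf_lbound; exists A => //; split.
- apply: le_ereal_inf_tmp => _ [B [mB BA] <-].
  by apply: le_measure => //; rewrite inE.
Qed.

Section product_power.
Context d (T : measurableType d) (R : realType).

Definition cons_pair (N : nat) (x : T * N.-tuple T) : N.+1.-tuple T :=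
  [tuple of x.1 :: x.2].

Lemma measurable_cons_pair N : measurable_fun setT (@cons_pair N).
Proof. by apply: measurable_cons. Qed.

HB.instance Definition _ N :=
  isMeasurableFun.Build _ _ _ _ (@cons_pair N) (@measurable_cons_pair N).

Fixpoint prob_power (P : probability T R) (N : nat) :
    probability (N.-tuple T) R :=
  if N is N'.+1 then distribution (P \x prob_power P N')%E (@cons_pair N')
  else \d_([tuple]).

Lemma prob_power_box (P : probability T R) N (A : 'I_N -> set T) :
  (forall i, measurable (A i)) ->
  prob_power P N [set s | forall i, A i (tnth s i)] = (\prod_i P (A i))%E.
Proof.
elim: N A => [A _|N IH A mA].
  by rewrite big_ord0 /= /dirac indicE mem_set// => -[].
rewrite big_ord_recl -IH//= /distribution /pushforward.
rewrite -product_measure1E//=; last first.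
  rewrite (_ : mkset _ = \big[setI/setT]_(i < N)
      ((fun s : N.-tuple T => tnth s i) @^-1` A (lift ord0 i))).
    apply: bigsetI_measurable => i _.
    by rewrite -[_ @^-1` _]setTI; exact: measurable_tnth.
  rewrite -bigcap_seq; apply/seteqP; split => [s h i _|s h i]; first exact: h.
  by apply: h; rewrite /= mem_index_enum.
congr product_measure1; apply/seteqP; split => -[x s] /=.
  move=> h; split; first by have := h ord0; rewrite /cons_pair.
  by move=> i; have := h (lift ord0 i); rewrite /cons_pair tnthS.
move=> [h0 h] i; rewrite /cons_pair /=.
by have [j ->|->] := unliftP ord0 i; rewrite ?tnthS.
Qed.

End product_power.

Variant worder := FiniteOrder of nat | InfiniteOrder.

Definition worder_ereal (R : realType) (p : worder) : \bar R :=
  if p is FiniteOrder q then q%:R%:E else +oo%E.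

Definition worder_ge1 (p : worder) : Prop :=
  if p is FiniteOrder q then (1 <= q)%N else True.

Section wasserstein.
Variables (R : realType) (m : nat) (nrm : 'rV[R]_m -> R).
Local Notation U := (borelRV R m).

Definition coupling (Q Q' : {measure set U -> \bar R})
    (Pi : probability (U * U)%type R) : Prop :=
  (forall A : set U, measurable A -> Pi (fst @^-1` A) = Q A) /\
  (forall A : set U, measurable A -> Pi (snd @^-1` A) = Q' A).

(* [Lnorm Pi p c] is [(\int c^p dPi)^(1/p)] for finite [p], and the
   [Pi]-essential supremum of [c] for [p = +oo]. *)
Definition wasserstein (p : worder) (Q Q' : {measure set U -> \bar R}) : \bar R :=
  ereal_inf
    [set Lnorm Pi (worder_ereal R p) (fun z : U * U => (nrm (z.1 - z.2))%:E)
    | Pi in coupling Q Q'].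

Definition empirical (N : nat) (d : N.-tuple U) : {measure set U -> \bar R} :=
  mscale (N%:R^-1)%:nng (msum (fun i => \d_(nth (0 : 'rV[R]_m) d i : U)) N).

Definition light_tailed (P : probability U R) : Prop :=
  exists a t : R, [/\ 0 < a, 0 < t &
    ('E_P[fun u : U => expR (t * (nrm u `^ a))] < +oo)%E].

(* [phi p] bounds the tail of the Wasserstein distance between [P] and the
   empirical distribution, and decays exponentially (possibly at a stretched
   exponential rate, as happens for light tails with small exponent). *)
Definition concentration_bound (p : worder) (P : probability U R)
    (phi : worder -> nat -> R -> R) : Prop :=
  (forall (N : nat) (eps : R), (0 < N)%N -> 0 < eps ->
    (outer_prob (prob_power P N)
       [set d | eps%:E <= wasserstein p P (empirical d)]
     <= (phi p N eps)%:E)%E) /\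
  (forall eps : R, 0 < eps -> exists c C s : R,
    [/\ 0 < c, 0 < C, 0 < s & forall N : nat, (0 < N)%N ->
      phi p N eps <= C * expR (- (c * (N%:R `^ s)))]).

End wasserstein.

(* Lebesgue measure on R^m: the Borel measure whose value on a box is the
   product of the side lengths. *)
Definition is_lebesgue (R : realType) (m : nat)
    (nu : {measure set (borelRV R m) -> \bar R}) : Prop :=
  forall a b : 'rV[R]_m, rV_le a b ->
    nu [set u : 'rV[R]_m | forall i, a ord0 i < u ord0 i <= b ord0 i] =
      (\prod_i (b ord0 i - a ord0 i))%:E.

(* Near each boundary point the open set [O] is, after a rotation of the axes
   taking the last one to the unit vector [e], the strict epigraph of a
   Lipschitz function [gamma] on the hyperplane orthogonal to [e]. *)
Definition lipschitz_boundary (R : realType) (m : nat) (O : set 'rV[R]_m) : Prop :=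
  forall x0, (closure O `\` O) x0 ->
  exists (e : 'rV[R]_m) (gamma : 'rV[R]_m -> R) (L r : R),
    [/\ 0 < r, dotp e e = 1,
        forall y z, dotp y e = 0 -> dotp z e = 0 ->
          `|gamma y - gamma z| <= L * `|y - z|
      & forall y, `|y - x0| < r ->
          (O y <-> gamma (y - dotp y e *: e) < dotp y e)].

Definition regular (R : realType) (m : nat) (S : set 'rV[R]_m)
    (P : probability (borelRV R m) R) : Prop :=
  [/\ bounded_set S°, connected S°, open S°, lipschitz_boundary S° &
    exists (nu : {measure set (borelRV R m) -> \bar R})
           (rho : borelRV R m -> R) (lambda : R),
      [/\ is_lebesgue nu,
          measurable_fun (S° : set (borelRV R m)) rho,
          forall A : set (borelRV R m), measurable A ->
            P A = (\int[nu]_(u in A `&` S°) (rho u)%:E)%E,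
          1 <= lambda
        & forall u, S° u -> lambda^-1 <= rho u <= lambda]].

Definition is_clustering (N K : nat) (C : 'I_K -> {set 'I_N}) : Prop :=
  [/\ forall k, exists i, i \in C k,
      forall k l i, i \in C k -> i \in C l -> k = l
    & forall i, exists k, i \in C k].

Section clusters.
Variables (R : realType) (m : nat) (nrm : 'rV[R]_m -> R).
Variables (N K : nat) (d : N.-tuple (borelRV R m)) (C : 'I_K -> {set 'I_N}).

Definition centroid (k : 'I_K) : 'rV[R]_m :=
  #|C k|%:R^-1 *: \sum_(i in C k) (tnth d i : 'rV[R]_m).

Definition weight (k : 'I_K) : R := #|C k|%:R / N%:R.

Definition eta (q : nat) : R :=
  N%:R^-1 * \sum_k \sum_(i in C k) nrm ((tnth d i : 'rV[R]_m) - centroid k) ^+ q.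

Definition eta_root (p : worder) : R :=
  match p with
  | FiniteOrder q => eta q `^ q%:R^-1
  | InfiniteOrder =>
      \big[Num.max/0]_k \big[Num.max/0]_(i in C k)
        nrm ((tnth d i : 'rV[R]_m) - centroid k)
  end.

End clusters.

Section mro.
Variables (R : realType) (m n J K : nat) (nrm : 'rV[R]_m -> R).
Variables (X : set 'rV[R]_n) (S : set 'rV[R]_m) (f : 'rV[R]_n -> R).
Variables (g : 'I_J -> 'rV[R]_m -> 'rV[R]_n -> \bar R).
Variables (p : worder) (w : 'I_K -> R) (dbar : 'I_K -> 'rV[R]_m) (eps : R).

Definition Gamma : set ('I_J -> 'I_K -> R) :=
  [set alpha | (forall k, \sum_j alpha j k = w k) /\
               (forall j k, 0 <= alpha j k)].

Definition uncertainty_set (alpha : 'I_J -> 'I_K -> R) :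
    set ('I_J -> 'I_K -> 'rV[R]_m) :=
  [set v | (forall j k, S (v j k)) /\
    match p with
    | FiniteOrder q =>
        \sum_k \sum_j alpha j k * nrm (v j k - dbar k) ^+ q <= eps ^+ q
    | InfiniteOrder =>
        \big[Num.max/0]_k
          (\sum_j alpha j k / w k * nrm (v j k - dbar k)) <= eps
    end].

Definition mro_feasible (x : 'rV[R]_n) : Prop :=
  X x /\
  forall alpha v, Gamma alpha -> uncertainty_set alpha v ->
    (\sum_k \sum_j (alpha j k)%:E * g j (v j k) x <= 0)%E.

Definition mro_optimal (x : 'rV[R]_n) : Prop :=
  mro_feasible x /\ forall y, mro_feasible y -> f x <= f y.

End mro.

(* Main.v *)
Require Import Defs.
From HB Require Import structures.
From mathcomp Require Import all_boot all_order all_algebra ring lra.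
From mathcomp Require Import all_classical all_reals all_analysis.
From mathcomp Require Import measurable_realfun.

(** Let [W] be the Wasserstein distance between [P] and the empirical
    distribution of the data. With outer probability at most [beta] it reaches
    the radius [epsN]; everywhere else on [S]^N the constraint turns out to hold
    in expectation, for every feasible decision [x] and without any further
    randomness ([mean_le0_of_wasserstein_lt]).

    So let [W < epsN] and take a coupling of [P] with the empirical distribution
    whose cost [s] is below [epsN] ([transport_plan]). It transports the mass of
    [P] to the data points, hence to the clusters. Cut [S] into cells, the [j]-th
    one consisting of points where [g j] realizes the maximum of the constraint
    functions. Let [alpha j k] be the mass that the plan sends from the [j]-th
    cell to the [k]-th cluster, and let [v j k] be the barycenter of that mass.
    Two applications of Jensen's inequality give the result:

    - the function [nrm (u - c) ^+ q] is convex, so the pair [(alpha, v)] is no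
      further from the centroids than [P] itself; by the triangle inequality in
      $L^q$ this distance is at most [s] (from [P] to the data) plus the root of
      the clustering error (from the data to the centroids), so [(alpha, v)]
      belongs to the uncertainty set ([mixture_cost_finite],
      [mixture_cost_infinite]);
    - the functions [g j] are concave, so the mean of their maximum under [P] is
      at most the sum of the [alpha j k * g j (v j k) x] ([mixture_value]), and
      this sum is nonpositive because [x] is feasible.

    Jensen's inequality is needed for extended-valued lower semicontinuous convex
    functions on $R^m$. It says that the barycenter of points of the epigraph
    stays in the epigraph, and follows from the strict separation of a point from
    a closed convex set ([strict_separation], [barycenter_in], [jensen]).

    The maximum of the [g j] might not be integrable. It is bounded above by an
    integrable function, since a proper convex lower semicontinuous function has an
    affine minorant; so its integral is then [-oo] ([integral_le0_dichotomy]). *)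

Set Implicit Arguments.
Unset Strict Implicit.
Unset Printing Implicit Defensive.
Import Order.TTheory GRing.Theory Num.Theory.
Import numFieldNormedType.Exports.
Local Open Scope classical_set_scope.
Local Open Scope ring_scope.

(** * Separation of convex sets and affine minorants *)

Section convex_sets.
Context {R : realType}.

(** Elementary form of [convex_set], which is stated on a type alias carrying
    barycentric combinations. *)
Definition convex_in (m : nat) (E : set 'rV[R]_m) :=
  forall (t : R) (x y : 'rV[R]_m), 0 <= t <= 1 -> E x -> E y ->
    E (t *: x + (1 - t) *: y).

Lemma dotpC m (u v : 'rV[R]_m) : dotp u v = dotp v u.
Proof. by apply: eq_bigr => i _; rewrite mulrC. Qed.

Lemma dotpDr m (u v w : 'rV[R]_m) : dotp u (v + w) = dotp u v + dotp u w.
Proof. by rewrite -big_split; apply: eq_bigr => i _; rewrite mxE mulrDr. Qed.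

Lemma dotpZr m a (u v : 'rV[R]_m) : dotp u (a *: v) = a * dotp u v.
Proof. by rewrite mulr_sumr; apply: eq_bigr => i _; rewrite mxE mulrCA. Qed.

Lemma dotpNr m (u v : 'rV[R]_m) : dotp u (- v) = - dotp u v.
Proof. by rewrite -scaleN1r dotpZr mulN1r. Qed.

Lemma dotpDl m (u v w : 'rV[R]_m) : dotp (v + w) u = dotp v u + dotp w u.
Proof. by rewrite dotpC dotpDr !(dotpC u). Qed.

Lemma dotpZl m a (u v : 'rV[R]_m) : dotp (a *: v) u = a * dotp v u.
Proof. by rewrite dotpC dotpZr dotpC. Qed.

Lemma dotp0l m (u : 'rV[R]_m) : dotp 0 u = 0.
Proof. by rewrite -(scale0r 0) dotpZl mul0r. Qed.

Lemma dotp_ge_sqr m (u : 'rV[R]_m) i : u ord0 i ^+ 2 <= dotp u u.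
Proof.
rewrite /dotp (bigD1 i)//= expr2 lerDl sumr_ge0// => j _.
by rewrite -expr2 sqr_ge0.
Qed.

Lemma dotp_ge0 m (u : 'rV[R]_m) : 0 <= dotp u u.
Proof. by rewrite sumr_ge0// => j _; rewrite -expr2 sqr_ge0. Qed.

Lemma dotp_gt0 m (u : 'rV[R]_m) : u != 0 -> 0 < dotp u u.
Proof.
move=> u0; rewrite lt_neqAle dotp_ge0 andbT; apply: contra u0 => /eqP uu0.
apply/eqP/rowP => i; rewrite mxE; apply/eqP; rewrite -sqrf_eq0.
by apply/eqP/le_anti; rewrite sqr_ge0 andbT uu0 dotp_ge_sqr.
Qed.

Lemma continuous_sumr (T : topologicalType) (I : Type) (s : seq I)
    (F : I -> T -> R) :
  (forall i, continuous (F i)) -> continuous (fun u => \sum_(i <- s) F i u).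
Proof.
move=> cF; elim: s => [|i s IH] u.
  by under eq_fun do rewrite big_nil; exact: cst_continuous.
under eq_fun do rewrite big_cons.
by apply: continuousD; [exact: cF|exact: IH].
Qed.

Lemma dist2_continuous m (b : 'rV[R]_m) :
  continuous (fun e : 'rV[R]_m => dotp (e - b) (e - b)).
Proof.
apply: continuous_sumr => i.
have cc : continuous (fun e : 'rV[R]_m => (e - b) ord0 i).
  rewrite (_ : (fun _ => _) = fun e : 'rV[R]_m => e ord0 i - b ord0 i); last first.
    by apply/funext => e; rewrite 2!mxE.
  move=> u; apply: continuousB; [exact: coord_continuous|exact: cst_continuous].
move=> u; exact: (continuousM (cc u) (cc u)).
Qed.

Lemma rV_norm_le m (u : 'rV[R]_m) (M : R) : 0 <= M ->
  (forall i, `|u ord0 i| <= M) -> `|u| <= M.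
Proof.
move=> M0 h; rewrite [leLHS]/Num.norm /= mx_normrE; apply: bigmax_le => // -[i j] _ /=.
by rewrite ord1.
Qed.

Lemma coord_le_norm m (u : 'rV[R]_m) i : `|u ord0 i| <= `|u|.
Proof.
rewrite [leRHS]/Num.norm /= mx_normrE.
by apply/bigmax_geP; right => /=; exists (ord0, i).
Qed.

(** Only the part of [E] not further from [b] than a given point of [E] matters,
    and it is compact. *)
Lemma nearest_point m (E : set 'rV[R]_m) b : closed E -> E !=set0 ->
  exists2 e, E e & forall e', E e' ->
    dotp (e - b) (e - b) <= dotp (e' - b) (e' - b).
Proof.
move=> clE [e0 Ee0]; pose q (e : 'rV[R]_m) := dotp (e - b) (e - b).
have cq : continuous q := @dist2_continuous m b.
pose K := E `&` [set e | q e <= q e0].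
have clK : closed K.
  apply: closedI => //.
  by rewrite (_ : mkset _ = q @^-1` [set x | x <= q e0])//;
    apply: closed_comp => [x _|]; [exact: cq|exact: closed_le].
have bK : bounded_set K.
  exists (`|b| + (1 + q e0)); split; first exact: num_real.
  move=> M ltM e [_ /= qe]; rewrite (le_trans _ (ltW ltM))//.
  rewrite -[e in leLHS](subrK b) addrC (le_trans (ler_normD _ _))//.
  have q0 : 0 <= q e0 by exact: dotp_ge0.
  rewrite lerD2l; apply: rV_norm_le; first by rewrite addr_ge0.
  move=> i; have := le_trans (dotp_ge_sqr (e - b) i) qe.
  rewrite -(real_normK (num_real _)); set x := `|_| => hx.
  have x0 : 0 <= x by exact: normr_ge0.
  by move: hx q0; set y := q e0; nra.
have [||e eK he] := @EVT_min_rV _ _ q K _ (bounded_closed_compact bK clK).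
- by exists e0; split => //=.
- exact: continuous_subspaceT.
move: eK; rewrite inE => -[Ee /= qe]; exists e => // e' Ee'.
have [|] := leP (q e') (q e0); last by move=> /ltW; exact: le_trans.
by move=> h; apply: he; rewrite inE; split.
Qed.

(** The hyperplane through the point of [E] nearest to [b], orthogonal to the
    direction from [b] to that point, separates strictly. *)
Lemma strict_separation m (E : set 'rV[R]_m) b :
  closed E -> convex_in E -> ~ E b ->
  exists c s, dotp c b < s /\ forall e, E e -> s <= dotp c e.
Proof.
move=> clE cvE Eb; have [->|/set0P E0] := eqVneq E set0.
  by exists 0, 1; rewrite dotp0l; split.
have [e Ee emin] := nearest_point b clE E0.
have eb : e - b != 0 by apply/eqP => /subr0_eq eb; apply: Eb; rewrite -eb.
exists (e - b), (dotp (e - b) e); split.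
  by rewrite -subr_gt0 -dotpNr -dotpDr dotp_gt0.
move=> f Ef; rewrite -subr_ge0 -dotpNr -dotpDr leNgt; apply/negP => D0.
set D := dotp _ _ in D0; pose Q := dotp (f - e) (f - e).
have Q0 : 0 <= Q by exact: dotp_ge0.
(* moving from [e] towards [f] by this fraction would get closer to [b] *)
pose t := - D / (Q - D).
have QD : 0 < Q - D by lra.
have tE : t * (Q - D) = - D by rewrite /t mulfVK// gt_eqF.
have t0 : 0 < t by rewrite /t divr_gt0//; lra.
have t1 : t <= 1 by rewrite /t ler_pdivrMr//; lra.
have := emin _ (cvE t f e _ Ef Ee); rewrite (ltW t0) t1 => /(_ isT).
rewrite (_ : t *: f + (1 - t) *: e - b = (e - b) + t *: (f - e)); last first.
  by apply/rowP => i; rewrite !mxE; ring.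
have expand (u w : 'rV[R]_m) : dotp (u + t *: w) (u + t *: w) =
    dotp u u + t * (2 * dotp u w + t * dotp w w).
  by rewrite !(dotpDl, dotpDr, dotpZl, dotpZr) (dotpC w u); ring.
rewrite expand lerDl pmulr_rge0// -/D -/Q.
by nra.
Qed.

End convex_sets.

Section epigraph.
Context {R : realType} {m : nat}.
Implicit Type h : 'rV[R]_m -> \bar R.

(** The level is stored in an additional last coordinate, so that the separation
    of points of [R^m * R] is an instance of the one of row vectors. *)
Definition epi h : set 'rV[R]_(m + 1) :=
  [set z | (h (lsubmx z) <= (z ord0 (rshift m ord0))%:E)%E].

Lemma epi_row_mx h u (y : R) : epi h (row_mx u y%:M) = (h u <= y%:E)%E :> Prop.
Proof. by rewrite /epi /= row_mxKl row_mxEr mxE eqxx mulr1n. Qed.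

Lemma dotp_epi (c : 'rV[R]_(m + 1)) u (y : R) :
  dotp c (row_mx u y%:M) = dotp (lsubmx c) u + c ord0 (rshift m ord0) * y.
Proof.
rewrite /dotp big_split_ord /= big_ord_recl big_ord0 addr0 row_mxEr mxE eqxx mulr1n.
by congr (_ + _); apply: eq_bigr => i _; rewrite row_mxEl mxE.
Qed.

(** Between a point strictly below the graph and the graph there is room for a
    level [a], and [h] stays above [a] nearby. *)
Lemma epi_closed h : lower_semicontinuous h -> closed (epi h).
Proof.
move=> /lower_semicontinuousP lsc; rewrite -openC openE => z /=.
rewrite /epi /= => /negP; rewrite -ltNge => rh.
have [a ra ah] : exists2 a, z ord0 (rshift m ord0) < a & (a%:E < h (lsubmx z))%E.
  move: (h _) rh => [x| |]//=.
    rewrite lte_fin => zx; exists ((z ord0 (rshift m ord0) + x) / 2).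
      by rewrite midf_lt.
    by rewrite lte_fin midf_lt.
  by move=> _; exists (z ord0 (rshift m ord0) + 1); rewrite ?ltrDl ?ltry.
have n1 : nbhs z [set z' | (a%:E < h (lsubmx z'))%E].
  have := @continuous_lsubmx R 1 m 1 z [set u | (a%:E < h u)%E].
  by apply; apply: open_nbhs_nbhs; split => //; exact: lsc.
have n2 : nbhs z [set z' : 'rV[R]_(m + 1) | z' ord0 (rshift m ord0) < a].
  have := @coord_continuous R 1 (m + 1) ord0 (rshift m ord0) z [set y | y < a].
  by apply; apply: open_nbhs_nbhs; split => //; exact: open_lt.
apply: filterS2 n1 n2 => z' /= h1 h2; apply/negP; rewrite -ltNge.
by rewrite (lt_trans _ h1)// lte_fin.
Qed.

Lemma epi_convex h : econvex_fun h -> convex_in (epi h).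
Proof.
move=> ch t x y t01; rewrite /epi /= => hx hy.
rewrite !linearD !linearZ /= !mxE EFinD !EFinM.
apply: (le_trans (ch _ _ _ t01)); case/andP: t01 => t0 t1.
by apply: leeD; apply: lee_wpmul2l; rewrite ?lee_fin ?subr_ge0.
Qed.

(** A point strictly below the graph is separated from the epigraph by a
    hyperplane, which cannot be vertical because it also separates the point
    from the graph point above it. *)
Lemma affine_minorant h : proper_fun h -> econvex_fun h ->
  lower_semicontinuous h ->
  exists c (a : 'rV[R]_m), forall u, ((c + dotp a u)%:E <= h u)%E.
Proof.
move=> [hN [u0 hu0]] cvx lsc.
have [y0 y0E] : exists y0, h u0 = y0%:E.
  by move: (hN u0) hu0; case: (h u0) => [y||]//; exists y.
have [|c [s [cs sc]]] := strict_separation (epi_closed lsc) (epi_convex cvx)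
    (_ : ~ epi h (row_mx u0 (y0 - 1)%:M)).
  by rewrite epi_row_mx y0E lee_fin; apply/negP; rewrite -ltNge; lra.
set b := c ord0 (rshift m ord0); pose a := lsubmx c.
have sc' u y : (h u <= y%:E)%E -> s <= dotp a u + b * y.
  by move=> huy; rewrite -dotp_epi; apply: sc; rewrite epi_row_mx.
move: cs; rewrite dotp_epi -/a -/b => cs.
have b0 : 0 < b by have := sc' u0 y0; rewrite y0E lexx => /(_ isT); lra.
exists (s / b), (- b^-1 *: a) => u.
case: (h u) (hN u) (sc' u) => [y||]// _; last by rewrite leey.
rewrite lee_fin dotpZl mulNr mulrC -mulrBr => /(_ _ (lexx _)) sy.
by rewrite mulrC ler_pdivrMr//; lra.
Qed.

End epigraph.

(** * Barycenters and Jensen's inequality *)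

Section real_integrals.
Context d (T : measurableType d) (R : realType).
Variables (mu : {measure set T -> \bar R}) (D : set T).
Hypothesis mD : measurable D.

Definition Rintegrable (f : T -> R) := mu.-integrable D (EFin \o f).

Lemma eq_Rintegrable (f g : T -> R) : (forall x, D x -> f x = g x) ->
  Rintegrable f -> Rintegrable g.
Proof.
by move=> fg; apply: eq_integrable => // x; rewrite inE => /fg /= ->.
Qed.

Lemma RintegrableD (f g : T -> R) : Rintegrable f -> Rintegrable g ->
  Rintegrable (fun x => f x + g x).
Proof. by move=> fi gi; exact: (integrableD mD fi gi). Qed.

Lemma RintegrableZ (k : R) (f : T -> R) : Rintegrable f -> Rintegrable (fun x => k * f x).
Proof. by move=> fi; exact: (integrableZl mD k fi). Qed.

Lemma Rintegrable_sum I (s : seq I) (P : pred I) (F : I -> T -> R) :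
  (forall i, P i -> Rintegrable (F i)) ->
  Rintegrable (fun x => \sum_(i <- s | P i) F i x).
Proof.
move=> Fi; rewrite /Rintegrable (_ : _ \o _ =
    fun x => (\sum_(i <- s | P i) (F i x)%:E)%E).
  exact: (integrable_sum mD).
by apply/funext => x /=; rewrite sumEFin.
Qed.

Lemma Rintegral_sum I (s : seq I) (P : pred I) (F : I -> T -> R) :
  (forall i, P i -> Rintegrable (F i)) ->
  \int[mu]_(x in D) (\sum_(i <- s | P i) F i x) =
  \sum_(i <- s | P i) \int[mu]_(x in D) F i x.
Proof.
move=> Fi; elim: s => [|i s IH].
  rewrite big_nil; under eq_Rintegral do rewrite big_nil.
  by rewrite Rintegral_cst// mul0r.
rewrite big_cons; under eq_Rintegral do rewrite big_cons.
case: ifPn => Pi //; rewrite RintegralD ?IH//; first exact: Fi.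
exact: Rintegrable_sum.
Qed.

Lemma le_Rintegrable (f g : T -> R) : measurable_fun D f ->
  (forall x, D x -> `|f x| <= g x) -> Rintegrable g -> Rintegrable f.
Proof.
move=> mf fg; apply: le_integrable => //; first exact/measurable_EFinP.
by move=> x Dx /=; rewrite lee_fin (le_trans (fg _ Dx))// ler_norm.
Qed.

Lemma Rintegrable_weight (w f : T -> R) : measurable_fun D w ->
  (forall x, D x -> 0 <= w x <= 1) -> Rintegrable f ->
  Rintegrable (fun x => w x * f x).
Proof.
move=> mw w01 fi; apply: (@le_Rintegrable _ (fun x => `|f x|)).
- apply: measurable_funM => //; apply/measurable_EFinP.
  exact: measurable_int fi.
- move=> x /w01/andP[w0 w1] /=; rewrite normrM (ger0_norm w0).
  by rewrite ler_piMl.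
- exact: integrable_norm.
Qed.

Lemma Rintegrable_cst (k : R) : (mu D < +oo)%E -> Rintegrable (fun=> k).
Proof.
move=> Dfin; apply: measurable_bounded_integrable => //.
by exists `|k|; split => // M kM x _ /=; exact: ltW.
Qed.

End real_integrals.

Section barycenters.
Context d (T : measurableType d) (R : realType).
Variables (mu : {measure set T -> \bar R}) (D : set T).
Hypothesis mD : measurable D.

Definition barycenter m (w : T -> R) (Z : T -> 'rV[R]_m) : 'rV[R]_m :=
  \row_i ((\int[mu]_(x in D) w x)^-1 * \int[mu]_(x in D) (w x * Z x ord0 i)).

(** A hyperplane separating strictly the barycenter from the set would give a
    strict inequality between an integral and itself. *)
Lemma barycenter_in m (E : set 'rV[R]_m) (w : T -> R) (Z : T -> 'rV[R]_m) :
  closed E -> convex_in E ->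
  (forall x, D x -> 0 <= w x) -> Rintegrable mu D w ->
  0 < \int[mu]_(x in D) w x ->
  (forall i, Rintegrable mu D (fun x => w x * Z x ord0 i)) ->
  (forall x, D x -> w x != 0 -> E (Z x)) ->
  E (barycenter w Z).
Proof.
move=> clE cvE w0 wi a0 wZi EZ; apply: contrapT => nE.
have [c [s [cs sc]]] := strict_separation clE cvE nE.
have cZ x : w x * dotp c (Z x) = \sum_i c ord0 i * (w x * Z x ord0 i).
  by rewrite mulr_sumr; apply: eq_bigr => i _; rewrite mulrCA.
have cZi : Rintegrable mu D (fun x => w x * dotp c (Z x)).
  apply: (eq_Rintegrable mD (f := fun x => \sum_i c ord0 i * (w x * Z x ord0 i))).
    by move=> x _; rewrite cZ.
  by apply: Rintegrable_sum => // i _; exact: RintegrableZ.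
have : s * \int[mu]_(x in D) w x <= \int[mu]_(x in D) (w x * dotp c (Z x)).
  rewrite -RintegralZl//; apply: le_Rintegral => //.
    exact: (RintegrableZ mD s).
  move=> x Dx; rewrite mulrC; have [->|wx0] := eqVneq (w x) 0; first by rewrite !mul0r.
  by apply: ler_wpM2l; [exact: w0|exact/sc/EZ].
rewrite (eq_Rintegral mu (f := fun x => w x * dotp c (Z x))
    (g := fun x => \sum_i c ord0 i * (w x * Z x ord0 i))); last first.
  by move=> x _; exact: cZ.
rewrite Rintegral_sum//; last by move=> i _; exact: RintegrableZ.
rewrite (_ : \sum_i _ = (\int[mu]_(x in D) w x) * dotp c (barycenter w Z)).
  by rewrite mulrC ler_pM2l// leNgt cs.
rewrite mulr_sumr; apply: eq_bigr => i _; rewrite RintegralZl//; last exact: wZi.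
by rewrite mxE mulrCA mulVKf// gt_eqF.
Qed.

(** The points [(Z, H)] lie in the epigraph of [h], which is closed and convex, so
    their barycenter stays in it. *)
Lemma jensen m (h : 'rV[R]_m -> \bar R) (w H : T -> R) (Z : T -> 'rV[R]_m) :
  lower_semicontinuous h -> econvex_fun h ->
  (forall x, D x -> 0 <= w x) -> Rintegrable mu D w ->
  0 < \int[mu]_(x in D) w x ->
  (forall i, Rintegrable mu D (fun x => w x * Z x ord0 i)) ->
  Rintegrable mu D (fun x => w x * H x) ->
  (forall x, D x -> w x != 0 -> (h (Z x) <= (H x)%:E)%E) ->
  (h (barycenter w Z) <=
    ((\int[mu]_(x in D) w x)^-1 * \int[mu]_(x in D) (w x * H x))%:E)%E.
Proof.
move=> lsc cvx w0 wi a0 wZi wHi hZ.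
have s11 (a : R) (i j : 'I_1) : (a%:M : 'M[R]_1) i j = a by rewrite !ord1 mxE mulr1n.
have := barycenter_in (epi_closed lsc) (epi_convex cvx) w0 wi a0
  (Z := fun x => row_mx (Z x) (H x)%:M).
rewrite (_ : barycenter w _ = row_mx (barycenter w Z)
    ((\int[mu]_(x in D) w x)^-1 * \int[mu]_(x in D) (w x * H x))%:M); last first.
  apply/rowP => i; rewrite mxE; have [j ->|j ->] := split_ordP i.
    by rewrite row_mxEl mxE; congr (_ * _); apply: eq_Rintegral => x _; rewrite row_mxEl.
  rewrite row_mxEr s11; congr (_ * _).
  by apply: eq_Rintegral => x _; rewrite row_mxEr s11.
rewrite epi_row_mx; apply.
  move=> i; have [j ->|j ->] := split_ordP i.
    by apply: (eq_Rintegrable mD) (wZi j) => x _; rewrite row_mxEl.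
  by apply: (eq_Rintegrable mD) wHi => x _; rewrite row_mxEr s11.
by move=> x Dx wx0; rewrite epi_row_mx; exact: hZ.
Qed.

End barycenters.

(** * Norms and Borel functions *)

Section norms.
Context {R : realType} {m : nat} {nrm : 'rV[R]_m -> R}.
Hypothesis hnrm : is_norm nrm.

Lemma nrmZ a u : nrm (a *: u) = `|a| * nrm u. Proof. by case: hnrm. Qed.
Lemma nrmD u v : nrm (u + v) <= nrm u + nrm v. Proof. by case: hnrm. Qed.

Lemma nrm0 : nrm 0 = 0.
Proof. by rewrite -(scale0r 0) nrmZ normr0 mul0r. Qed.

Lemma nrmN u : nrm (- u) = nrm u.
Proof. by rewrite -scaleN1r nrmZ normrN1 mul1r. Qed.

Lemma nrm_ge0 u : 0 <= nrm u.
Proof.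
have := nrmD u (- u); rewrite subrr nrm0 nrmN -mulr2n.
by rewrite pmulrn_lge0.
Qed.

Lemma nrm_le_norm : exists2 M, 0 <= M & forall u, nrm u <= M * `|u|.
Proof.
exists (\sum_i nrm (delta_mx ord0 i)); first by apply: sumr_ge0 => i _; exact: nrm_ge0.
move=> u; rewrite {1}(row_sum_delta u) mulr_suml.
elim/big_ind2: _ => [|x1 x2 y1 y2 h1 h2|i _]; first by rewrite nrm0.
  by rewrite (le_trans (nrmD _ _))// lerD.
by rewrite nrmZ mulrC; apply: ler_wpM2l; [exact: nrm_ge0|exact: coord_le_norm].
Qed.

Lemma nrm_continuous : continuous nrm.
Proof.
have [M M0 hM] := nrm_le_norm => u.
apply/(cvgrPdist_lt (FF := nbhs_filter u)) => e e0; apply/nbhs_ballP; exists (e / (M + 1)).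
  by rewrite /= divr_gt0// ltr_wpDl.
move=> v; rewrite -ball_normE /= ltr_pdivlMr ?ltr_wpDl// => h.
apply: le_lt_trans h.
have lip x y : nrm x - nrm y <= `|x - y| * (M + 1).
  have := nrmD (x - y) y; rewrite subrK -lerBlDr => /le_trans; apply.
  by rewrite mulrC (le_trans (hM _))// ler_wpM2r// lerDl.
by rewrite ler_norml lip andbT lerNl opprB distrC lip.
Qed.

(** The constant is the inverse of the minimum of [nrm] on the unit sphere of the
    sup norm, which is attained by compactness. *)
Lemma norm_le_nrm : exists2 c, 0 < c & forall u, `|u| <= c * nrm u.
Proof.
pose sphere := [set u : 'rV[R]_m | `|u| = 1].
have unit u : u != 0 -> sphere (`|u|^-1 *: u).
  move=> u0; rewrite /sphere /= normrZ normfV normr_id mulVf// normr_eq0//.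
have [s0|/set0P s0] := eqVneq sphere set0.
  exists 1 => // u; have [->|/unit] := eqVneq u 0; last by rewrite s0.
  by rewrite normr0 nrm0 mulr0.
have clS : closed sphere.
  rewrite (_ : sphere = (fun u : 'rV[R]_m => `|u|) @^-1` [set x | x = 1])//.
  by apply: closed_comp => [x _|]; [exact: norm_continuous|exact: closed_eq].
have bS : bounded_set sphere.
  by exists 1; split => // M M1 u /= ->; exact: ltW.
have [|v vS hv] := @EVT_min_rV _ _ nrm sphere s0 (bounded_closed_compact bS clS).
  by apply: continuous_subspaceT; exact: nrm_continuous.
have v0 : 0 < nrm v.
  rewrite lt_neqAle nrm_ge0 andbT eq_sym; apply/eqP => nv.
  move: vS; rewrite inE /sphere /=; have [/(_ _ nv) -> _ _] := hnrm.
  by rewrite normr0 => /esym/eqP; rewrite oner_eq0.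
exists (nrm v)^-1; first by rewrite invr_gt0.
move=> u; have [->|u0] := eqVneq u 0; first by rewrite normr0 nrm0 mulr0.
have := hv (`|u|^-1 *: u); rewrite inE => /(_ (unit _ u0)).
rewrite nrmZ normfV normr_id ler_pdivlMl ?normr_gt0// mulrC => h.
by rewrite ler_pdivlMl.
Qed.

(** By induction: once the bound for [q] is used, the defect left at [q.+1] is
    [t * (1 - t) * ((a - b) * (a ^+ q - b ^+ q))], and [x ^+ q] is monotone. *)
Lemma exprn_convex (t a b : R) q : 0 <= t <= 1 -> 0 <= a -> 0 <= b ->
  (t * a + (1 - t) * b) ^+ q <= t * a ^+ q + (1 - t) * b ^+ q.
Proof.
move=> /andP[t0 t1] a0 b0; elim: q => [|q IH].
  by rewrite !expr0 !mulr1 addrC subrK.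
have s0 : 0 <= 1 - t by rewrite subr_ge0.
rewrite exprS (le_trans (ler_wpM2l _ IH))//.
  by rewrite addr_ge0// mulr_ge0.
have ab : 0 <= (a - b) * (a ^+ q - b ^+ q).
  have [ab|ba] := leP a b.
    by rewrite mulr_le0// subr_le0// lerXn2r.
  by rewrite mulr_ge0// subr_ge0 ?lerXn2r// ltW.
rewrite !exprS -subr_ge0.
rewrite [leRHS](_ : _ = t * (1 - t) * ((a - b) * (a ^+ q - b ^+ q))); last by ring.
exact: mulr_ge0 (mulr_ge0 t0 s0) ab.
Qed.

(** Convexity of [x ^+ q.+1] between [a / s] and [b / t]. Integrated when
    [s ^+ q.+1] and [t ^+ q.+1] bound the integrals of [a ^+ q.+1] and
    [b ^+ q.+1], it is the triangle inequality in $L^{q+1}$. *)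
Lemma exprSn_minkowski (a b s t : R) q : 0 <= a -> 0 <= b -> 0 < s -> 0 < t ->
  (a + b) ^+ q.+1 <=
  (s + t) ^+ q * ((s ^+ q)^-1 * a ^+ q.+1 + (t ^+ q)^-1 * b ^+ q.+1).
Proof.
move=> a0 b0 s0 t0; have st : 0 < s + t by rewrite addr_gt0.
have w01 : 0 <= s / (s + t) <= 1.
  by rewrite divr_ge0 ?(ltW s0) ?(ltW st)//= ler_pdivrMr// mul1r lerDl ltW.
have := exprn_convex q.+1 w01 (divr_ge0 a0 (ltW s0)) (divr_ge0 b0 (ltW t0)).
have -> : 1 - s / (s + t) = t / (s + t) by field; rewrite gt_eqF.
have -> : s / (s + t) * (a / s) + t / (s + t) * (b / t) = (a + b) / (s + t).
  by field; rewrite !gt_eqF.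
rewrite !expr_div_n ler_pdivrMr ?exprn_gt0// => /le_trans; apply.
rewrite le_eqVlt; apply/orP; left; apply/eqP.
by rewrite !exprS; field; rewrite ?expf_neq0 ?gt_eqF.
Qed.

Definition nrm_pow (c : 'rV[R]_m) q (u : 'rV[R]_m) : \bar R := (nrm (u - c) ^+ q)%:E.

Lemma econvex_nrm_pow c q : econvex_fun (nrm_pow c q).
Proof.
move=> t u v t01; rewrite /nrm_pow -!EFinM -EFinD lee_fin.
apply: le_trans (exprn_convex _ t01 (nrm_ge0 _) (nrm_ge0 _)).
case/andP: t01 => t0 t1; apply: lerXn2r; rewrite ?nnegrE ?nrm_ge0//.
  by rewrite addr_ge0// mulr_ge0 ?nrm_ge0 ?subr_ge0.
rewrite (_ : _ - c = t *: (u - c) + (1 - t) *: (v - c)); last first.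
  by apply/rowP => i; rewrite !mxE; ring.
rewrite (le_trans (nrmD _ _))// !nrmZ !ger0_norm// subr_ge0//.
Qed.

Lemma continuous_nrm_pow c q : continuous (fun u : 'rV[R]_m => nrm (u - c) ^+ q).
Proof.
move=> u; apply: (@continuous_comp _ _ _ (fun v : 'rV[R]_m => nrm (v - c)) (fun x : R => x ^+ q)).
  apply: (@continuous_comp _ _ _ (fun v : 'rV[R]_m => v - c) nrm); last exact: nrm_continuous.
  by apply: continuousB; [exact: cvg_id|exact: cst_continuous].
exact: exprn_continuous.
Qed.

End norms.

Section borel_functions.
Context {R : realType} {m : nat}.

Lemma open_borel (A : set 'rV[R]_m) : open A -> measurable (A : set (borelRV R m)).
Proof. by move=> oA; exact: sub_sigma_algebra. Qed.

Lemma closed_borel (A : set 'rV[R]_m) : closed A -> measurable (A : set (borelRV R m)).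
Proof.
move=> /closed_openC/open_borel/measurableC.
by rewrite setCK.
Qed.

Lemma continuous_lsc (T : topologicalType) (f : T -> R) :
  continuous f -> lower_semicontinuous (EFin \o f).
Proof.
move=> cf; apply/lower_semicontinuousP => a.
rewrite (_ : mkset _ = f @^-1` [set x | a < x]).
  by apply: open_comp => [x _|]; [exact: cf|exact: open_gt].
by apply/funext => x; rewrite /= lte_fin.
Qed.

Lemma lsc_measurable (f : 'rV[R]_m -> \bar R) : lower_semicontinuous f ->
  measurable_fun setT (f : borelRV R m -> \bar R).
Proof.
move=> scif; apply: (measurability _ (ErealGenOInfty.measurableE R)).
move=> /= _ [_ [a ->]] <-; apply: measurableI => //; apply: open_borel.
by rewrite preimage_itvoy; move/lower_semicontinuousP : scif; exact.
Qed.

Lemma continuous_borel (f : 'rV[R]_m -> R) : continuous f ->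
  measurable_fun setT (f : borelRV R m -> R).
Proof. by move=> /continuous_lsc/lsc_measurable/measurable_EFinP. Qed.

End borel_functions.

(** * Transport plans of small cost *)

Section full_measure.
Context d (T : measurableType d) (R : realType) (mu : probability T R).

Lemma measureI_full (A D : set T) : measurable A -> measurable D ->
  mu D = 1%E -> mu (A `&` D) = mu A.
Proof.
move=> mA mD D1; rewrite [RHS](measureDI mu mA mD) -[LHS]add0e.
have D0 : mu (~` D) = 0%E by rewrite probability_setC// D1 subee.
congr (_ + _)%E; apply/esym.
apply: (@subset_measure0 _ _ _ mu _ (~` D)); [exact: measurableD|exact: measurableC| |].
  by move=> x [].
exact: D0.
Qed.

(** The integral of a nonnegative function is a supremum over the simple functions
    below it, hence monotone for arbitrary functions. This spares a discussion of
    the measurability of the distance for the product sigma-algebra. *)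
Lemma integral_subset_le (D : set T) (f g : T -> \bar R) :
  (forall x, 0 <= f x)%E -> (forall x, D x -> f x = g x) ->
  (\int[mu]_(x in D) g x <= \int[mu]_x f x)%E.
Proof.
move=> f0 fg; rewrite integral_mkcond.
have gD x : ((g \_ D) x = if x \in D then f x else 0)%E.
  by rewrite patchE; case: ifPn => //; rewrite inE => /fg.
have gf x : ((g \_ D) x <= f x)%E by rewrite gD; case: ifP.
rewrite !ge0_integralTE//; last by move=> x; rewrite gD; case: ifP.
apply: ge_ereal_sup => _ [h hg <-]; apply: ereal_sup_ubound; exists h => // x.
exact: le_trans (hg x) (gf x).
Qed.

End full_measure.

Section transport_plan.
Context {R : realType} {m : nat} (nrm : 'rV[R]_m -> R).
Hypothesis hnrm : is_norm nrm.
Variables (N : nat) (d : N.-tuple (borelRV R m)).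
Hypothesis hN : (0 < N)%N.
Local Notation U := (borelRV R m).

Definition sample (i : 'I_N) : 'rV[R]_m := tnth d i.

(** Two data points may coincide and yet lie in different clusters, so the mass
    transported to a location has to be shared among its copies. *)
Definition multiplicity i : R := \sum_j (sample j == sample i)%:R.

Lemma multiplicity_ge1 i : 1 <= multiplicity i.
Proof. by rewrite /multiplicity (bigD1 i)//= eqxx lerDl sumr_ge0. Qed.

Lemma measurable_point u : measurable ([set u] : set U).
Proof.
apply: closed_borel; apply: accessible_closed_set1.
exact/hausdorff_accessible/norm_hausdorff.
Qed.

Lemma empiricalE (A : set U) :
  empirical d A = (N%:R^-1 * \sum_i \1_A (sample i))%:E.
Proof.
rewrite /empirical /= /mscale /= /msum EFinM; congr (_ * _)%E.
rewrite -sumEFin; apply: eq_bigr => i _.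
by rewrite /dirac /= /sample (tnth_nth (0 : 'rV[R]_m)).
Qed.

Lemma Lnorm_finite_bound (mu : probability (U * U)%type R) (D : set (U * U)) (q : nat) (s : R) :
  (1 <= q)%N -> 0 < s ->
  (Lnorm mu q%:R%:E (fun z : U * U => (nrm (z.1 - z.2))%:E) <= s%:E)%E ->
  (\int[mu]_(z in D) (nrm ((z.1 : 'rV[R]_m) - z.2) ^+ q)%:E <= (s ^+ q)%:E)%E.
Proof.
move=> q1 s0 Ls.
have q0 : q%:R != 0 :> R by rewrite pnatr_eq0 -lt0n.
apply: le_trans (_ : (_ `^ q%:R <= _)%E); last first.
  rewrite -powR_mulrn ?(ltW s0)// -poweR_EFin.
  by apply: (gt0_ler_poweR _ _ _ Ls); rewrite ?in_itv /= ?andbT ?leey ?Lnorm_ge0// ?lee_fin ltW.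
rewrite poweR_Lnorm//; apply: integral_subset_le => z.
  exact: poweR_ge0.
by move=> _; rewrite abse_EFin ger0_norm ?nrm_ge0// poweR_EFin powR_mulrn// nrm_ge0.
Qed.

Lemma Lnorm_infinite_bound (mu : probability (U * U)%type R) (s : R) :
  (Lnorm mu +oo (fun z : U * U => (nrm (z.1 - z.2))%:E) < s%:E)%E ->
  exists A : set (U * U), [/\ measurable A, mu A = 1%E &
    forall z, A z -> nrm ((z.1 : 'rV[R]_m) - z.2) <= s].
Proof.
have mu1 : (0 < mu setT)%E by rewrite probability_setT lte01.
rewrite unlock /Lnorm; case: ifPn => [_|/negP//].
move=> /ereal_inf_lt[y [B [mB B0 hB]] ys].
exists (~` B); split; first exact: measurableC.
  by rewrite probability_setC// (_ : mu B = 0%E) ?sube0//; exact: B0.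
move=> z Bz; rewrite -lee_fin; apply: le_trans (ltW ys).
apply: contrapT => h; apply: Bz; apply: hB => /= h'; apply: h.
by move: h'; rewrite ger0_norm ?nrm_ge0.
Qed.

Lemma lt_EFin_between (y : \bar R) (e : R) : 0 < e -> (y < e%:E)%E ->
  exists2 s, 0 < s < e & (y < s%:E)%E.
Proof.
move=> e0; case: y => [r||]//.
  rewrite lte_fin => re; exists ((Num.max r 0 + e) / 2).
    have : Num.max r 0 < e by rewrite gt_max re.
    have : 0 <= Num.max r 0 by rewrite le_max lexx orbT.
    by move: (Num.max r 0) => x x0 xe; apply/andP; split; lra.
  rewrite lte_fin; have : r <= Num.max r 0 by rewrite le_max lexx.
  have : Num.max r 0 < e by rewrite gt_max re.
  by lra.
by move=> _; exists (e / 2); rewrite ?ltNyr//; apply/andP; split; lra.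
Qed.

(** A coupling of small cost, seen on a set of full measure on which the second
    coordinate is a data point and, for the infinite order, the distance of the
    coordinates is controlled everywhere. *)
Lemma transport_plan (S : set 'rV[R]_m) (P : probability U R) (p : worder) (epsN : R) :
  closed S -> P S = 1%E -> worder_ge1 p -> 0 < epsN ->
  (wasserstein nrm p P (empirical d) < epsN%:E)%E ->
  exists (Pi : probability (U * U)%type R) (D : set (U * U)) (s : R),
  [/\ forall A : set U, measurable A -> Pi (fst @^-1` A) = P A,
      measurable D /\ Pi D = 1%E,
      [/\ forall z, D z -> S z.1, forall z, D z -> exists i, z.2 = sample i
        & forall i, Pi ((snd @^-1` [set sample i]) `&` D) = (N%:R^-1 * multiplicity i)%:E],
      0 < s < epsN
    & match p with
      | FiniteOrder q =>
        (\int[Pi]_(z in D) (nrm ((z.1 : 'rV[R]_m) - z.2) ^+ q)%:E <= (s ^+ q)%:E)%E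
      | InfiniteOrder => forall z, D z -> nrm ((z.1 : 'rV[R]_m) - z.2) <= s
      end].
Proof.
move=> clS PS p1 e0 /ereal_inf_lt[_ [Pi [c1 c2] <-]] /(lt_EFin_between e0)[s s0e Ls].
have mfst (A : set U) : measurable A -> measurable ((fst : U * U -> U) @^-1` A).
  by move=> mA; rewrite -[X in measurable X]setTI; exact: measurable_fst.
have msnd (A : set U) : measurable A -> measurable ((snd : U * U -> U) @^-1` A).
  by move=> mA; rewrite -[X in measurable X]setTI; exact: measurable_snd.
pose Data : set U := \big[setU/set0]_i [set sample i].
have mData : measurable Data.
  by apply: bigsetU_measurable => i _; exact: measurable_point.
have DataP u : Data u <-> exists i, u = sample i.
  rewrite /Data -bigcup_seq; split => [[i _ ->]|[i ->]]; first by exists i.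
  by exists i => //=; rewrite mem_index_enum.
have [A [mA A1 hA]] : exists A : set (U * U), [/\ measurable A, Pi A = 1%E &
    if p is InfiniteOrder then
      forall z, A z -> nrm ((z.1 : 'rV[R]_m) - z.2) <= s else True].
  case: p {p1} Ls => [q _|/Lnorm_infinite_bound//].
  by exists setT; split => //; exact: probability_setT.
pose B : set (U * U) := fst @^-1` S `&` snd @^-1` Data.
have mS : measurable (S : set U) by exact: closed_borel.
have mB : measurable B by apply: measurableI; [exact: mfst|exact: msnd].
have B1 : Pi B = 1%E.
  rewrite measureI_full ?c1//; [exact: mfst|exact: msnd|].
  rewrite c2// empiricalE (eq_bigr (fun=> 1)); last first.
    by move=> i _; rewrite indicE mem_set//; apply/DataP; exists i.
  by rewrite sumr_const card_ord -mulr_natr mul1r mulVf// pnatr_eq0 -lt0n.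
have mBA : measurable (B `&` A) by exact: measurableI.
have BA1 : Pi (B `&` A) = 1%E by rewrite (measureI_full mB mA A1).
exists Pi, (B `&` A), s; split => //.
- split; first by move=> z [[]].
    by move=> z [[_ /DataP]].
  move=> i; rewrite (measureI_full (msnd _ (measurable_point _)) mBA BA1).
  rewrite c2; last exact: measurable_point.
  rewrite empiricalE; congr (_ * _)%:E; apply: eq_bigr => j _.
  by rewrite indicE; congr (nat_of_bool _)%:R; apply/idP/eqP; rewrite inE.
- case: p p1 Ls hA => [q|] /= q1 Ls hA; last by move=> z [_ /hA].
  by case/andP: s0e => s0 _; apply: Lnorm_finite_bound => //; exact: ltW.
Qed.

End transport_plan.

(** * Cells of maximality and weighted barycenters *)

Section argmax_cells.
Context d (T : measurableType d) (R : realType) (J : nat).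
Variable F : 'I_J -> T -> \bar R.

Definition maxfun (u : T) : \bar R := \big[maxe/-oo%E]_j F j u.

(** Ties are broken in favour of the smallest index, which makes the cells a
    partition. *)
Definition argmax_cell j : set T :=
  [set u | F j u = maxfun u /\ forall i : 'I_J, (i < j)%N -> (F i u < maxfun u)%E].

Lemma argmax_cell_attained u : (0 < J)%N -> exists j, argmax_cell j u.
Proof.
move=> J0; pose j0 := Ordinal J0.
have le_max j : (F j u <= maxfun u)%E by exact: (le_bigmax _ (fun j => F j u)).
have [i0 Fi0] : exists i, F i u = maxfun u.
  have [i _ hi] := @eq_bigmax _ _ _ -oo%E j0 xpredT (fun j => F j u) isT (fun i _ => leNye _).
  by exists i.
pose j := [arg min_(j < i0 | F j u == maxfun u) (j : nat)].
exists j; rewrite /j; case: arg_minnP => [|k /eqP Fk kmin]; first exact/eqP.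
split=> // i ik; rewrite lt_neqAle le_max andbT; apply: contraTN ik => /kmin.
by rewrite -leqNgt.
Qed.

Lemma argmax_cell_sum u : (0 < J)%N -> \sum_j \1_(argmax_cell j) u = 1 :> R.
Proof.
move=> /(argmax_cell_attained u)[j [Fj jmin]].
rewrite (bigD1 j)//= big1 ?addr0; first by rewrite indicE mem_set.
move=> i ij; rewrite indicE memNset// => -[Fi imin].
have [h|h|h] := ltngtP i j.
- by have := jmin _ h; rewrite Fi ltxx.
- by have := imin _ h; rewrite Fj ltxx.
- by move/eqP: ij; apply; exact/val_inj.
Qed.

Lemma measurable_maxfun : (forall j, measurable_fun setT (F j)) ->
  measurable_fun setT maxfun.
Proof.
move=> mF; rewrite /maxfun; elim: (index_enum _) => [|i s IH].
  by under eq_fun do rewrite big_nil; exact: measurable_cst.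
by under eq_fun do rewrite big_cons; exact: measurable_maxe.
Qed.

Lemma measurable_argmax_cell j : (forall j, measurable_fun setT (F j)) ->
  measurable (argmax_cell j).
Proof.
move=> mF; have mM := measurable_maxfun mF.
rewrite (_ : argmax_cell j = [set u | F j u = maxfun u] `&`
   \big[setI/setT]_(i : 'I_J | (i < j)%N) [set u | (F i u < maxfun u)%E]).
  apply: measurableI.
    by rewrite -[X in measurable X]setTI; exact: measurable_eqe.
  apply: bigsetI_measurable => i _.
  by rewrite -[X in measurable X]setTI; exact: measurable_lte.
rewrite -bigcap_seq_cond; apply/seteqP; split => u [Fj h]; split => // i.
  by move=> /andP[_ ij]; exact: h.
by move=> ij; apply: h; rewrite /= mem_index_enum.
Qed.

End argmax_cells.

Section weighted_jensen.
Context d (T : measurableType d) (R : realType).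
Variables (mu : {measure set T -> \bar R}) (D : set T).
Hypothesis mD : measurable D.

(** The default value [u0] stands for the barycenter of a null mass. *)
Definition barycenter_or m u0 (w : T -> R) (Z : T -> 'rV[R]_m) : 'rV[R]_m :=
  if 0 < \int[mu]_(x in D) w x then barycenter mu D w Z else u0.

Lemma Rintegral_null_weight (w H : T -> R) : (forall x, D x -> 0 <= w x) ->
  Rintegrable mu D w -> \int[mu]_(x in D) w x = 0 ->
  measurable_fun D H -> \int[mu]_(x in D) (w x * H x) = 0.
Proof.
move=> w0 wi a0 mH; have mw : measurable_fun D w.
  exact/measurable_EFinP/(measurable_int mu).
have : (\int[mu]_(x in D) `|(w x)%:E|)%E = 0%E.
  rewrite (eq_integral (fun x => (w x)%:E)).
    by rewrite -[LHS]fineK ?[fine _]a0//; exact: integrable_fin_num.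
  by move=> x; rewrite inE => Dx; rewrite abse_EFin ger0_norm ?w0.
move=> /ae_eq_integral_abs-/(_ mD) wae.
have {}wae : ae_eq mu D (EFin \o w) (cst 0%E) by apply: wae; exact/measurable_EFinP.
rewrite /Rintegral (ae_eq_integral (cst 0%E))//; first by rewrite integral0.
  exact/measurable_EFinP/measurable_funM.
by apply: filterS wae => x h Dx; have [/= ->] := h Dx; rewrite mul0r.
Qed.

Lemma weighted_jensen m (h : 'rV[R]_m -> \bar R) u0 (w H : T -> R)
    (Z : T -> 'rV[R]_m) (y : R) :
  lower_semicontinuous h -> econvex_fun h ->
  (forall x, D x -> 0 <= w x) -> Rintegrable mu D w ->
  (forall i, Rintegrable mu D (fun x => w x * Z x ord0 i)) ->
  measurable_fun D H -> Rintegrable mu D (fun x => w x * H x) ->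
  (forall x, D x -> w x != 0 -> (h (Z x) <= (H x)%:E)%E) ->
  h (barycenter_or u0 w Z) = y%:E ->
  (\int[mu]_(x in D) w x) * y <= \int[mu]_(x in D) (w x * H x).
Proof.
move=> lsc cvx w0 wi wZi mH wHi hZ; rewrite /barycenter_or.
case: ifPn => a0 hy.
  have := jensen mD lsc cvx w0 wi a0 wZi wHi hZ.
  by rewrite hy lee_fin mulrC ler_pdivlMr// mulrC.
have a0' : \int[mu]_(x in D) w x = 0.
  by apply/le_anti; rewrite Rintegral_ge0// andbT leNgt.
by rewrite a0' mul0r Rintegral_null_weight.
Qed.

Lemma barycenter_or_in m (E : set 'rV[R]_m) u0 (w : T -> R) (Z : T -> 'rV[R]_m) :
  closed E -> convex_in E -> E u0 ->
  (forall x, D x -> 0 <= w x) -> Rintegrable mu D w ->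
  (forall i, Rintegrable mu D (fun x => w x * Z x ord0 i)) ->
  (forall x, D x -> w x != 0 -> E (Z x)) ->
  E (barycenter_or u0 w Z).
Proof.
move=> clE cvE Eu0 w0 wi wZi EZ; rewrite /barycenter_or; case: ifPn => // a0.
exact: barycenter_in.
Qed.

End weighted_jensen.

(** * The mixture of barycenters built from a transport plan *)

Section clusters_sums.
Variables (R : realType) (N K : nat) (C : 'I_K -> {set 'I_N}).
Hypothesis hC : is_clustering C.

Lemma sum_over_clusters (V : nmodType) (F : 'I_N -> V) :
  \sum_k \sum_(i in C k) F i = \sum_i F i.
Proof.
have [_ Cinj Ccover] := hC.
rewrite (exchange_big_dep xpredT)//=; apply: eq_bigr => i _.
have [k ki] := Ccover i; rewrite (big_pred1 k)// => l /=.
by apply/idP/eqP => [li|->//]; exact: Cinj li ki.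
Qed.

End clusters_sums.

(** The setting is a probability space carrying a random vector [Z] (in the
    application, the first coordinate of a coupling) and weights [lam i], where
    [lam i x] is the fraction of the mass at [x] that is transported to the
    [i]-th data point. All integrals are over a set [D] of full measure, on which
    the properties of interest hold everywhere. *)
Section mixture.
Context d (T : measurableType d) (R : realType) (mu : probability T R).
Variables (D : set T) (m N K J : nat).
Hypothesis mD : measurable D.
Variables (nrm : 'rV[R]_m -> R) (Z : T -> borelRV R m).
Variables (pts : N.-tuple (borelRV R m)) (lam : 'I_N -> T -> R).
Variables (C : 'I_K -> {set 'I_N}) (cell : 'I_J -> set (borelRV R m)).
Hypothesis hnrm : is_norm nrm.
Hypothesis mZ : measurable_fun setT Z.
Hypothesis mlam : forall i, measurable_fun setT (lam i).
Hypothesis lam01 : forall i x, 0 <= lam i x <= 1.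
Hypothesis lam_sum : forall x, D x -> \sum_i lam i x = 1.
Hypothesis lam_mass : forall i, \int[mu]_(x in D) lam i x = N%:R^-1.
Hypothesis hC : is_clustering C.
Hypothesis mcell : forall j, measurable (cell j).
Hypothesis cell_sum : forall x, D x -> \sum_j \1_(cell j) (Z x) = 1 :> R.

Let muD : (mu D < +oo)%E.
Proof. by rewrite (le_lt_trans (probability_le1 mu mD))// ltry. Qed.

Let lam_ge0 i x : 0 <= lam i x. Proof. by case/andP: (lam01 i x). Qed.

(** Density of the mass that goes from the [j]-th cell to the [k]-th cluster. *)
Definition mixture_weight j k x : R :=
  (\sum_(i in C k) lam i x) * \1_(cell j) (Z x).

Lemma measurable_continuous_Z (f : 'rV[R]_m -> R) : continuous f ->
  measurable_fun D (fun x => f (Z x)).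
Proof.
by move=> /continuous_borel cf; apply: measurable_funTS; exact: measurableT_comp cf mZ.
Qed.

Lemma sum_lam_cluster x : D x -> \sum_k \sum_(i in C k) lam i x = 1.
Proof. by move=> Dx; rewrite sum_over_clusters// lam_sum. Qed.

Lemma sum_mixture_weight k x : D x ->
  \sum_j mixture_weight j k x = \sum_(i in C k) lam i x.
Proof. by move=> Dx; rewrite -mulr_sumr cell_sum// mulr1. Qed.

Lemma cluster_lam01 k x : D x -> 0 <= \sum_(i in C k) lam i x <= 1.
Proof.
move=> Dx; apply/andP; split; first exact: sumr_ge0.
rewrite -(sum_lam_cluster Dx) (bigD1 k)//= lerDl sumr_ge0// => l _.
exact: sumr_ge0.
Qed.

Lemma mixture_weight01 j k x : D x -> 0 <= mixture_weight j k x <= 1.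
Proof.
move=> /cluster_lam01-/(_ k)/andP[c0 c1]; rewrite /mixture_weight indicE.
by case: (_ \in _); rewrite ?mulr1 ?mulr0 ?c0 ?lexx ?ler01.
Qed.

Lemma mixture_weight_ge0 j k x : D x -> 0 <= mixture_weight j k x.
Proof. by move=> /mixture_weight01-/(_ j k)/andP[]. Qed.

Lemma mixture_weight_neq0 j k x : mixture_weight j k x != 0 ->
  cell j (Z x) /\ exists2 i, i \in C k & lam i x != 0.
Proof.
rewrite mulf_eq0 negb_or => /andP[h1 h2]; split.
  apply: contrapT => nc; move: h2; rewrite indicE memNset//.
  by rewrite eqxx.
apply: contrapT => h; move: h1; rewrite big1 ?eqxx// => i iC.
by apply/eqP; apply: contrapT => /negP l0; apply: h; exists i.
Qed.

Lemma measurable_mixture_weight j k : measurable_fun D (mixture_weight j k).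
Proof.
apply: measurable_funTS; apply: measurable_funM.
  rewrite (_ : (fun _ => _) = fun x => \sum_i if i \in C k then lam i x else 0).
    by apply: measurable_sum => i; case: (i \in C k); [exact: mlam|exact: measurable_cst].
  by apply/funext => x; rewrite big_mkcond.
apply: measurableT_comp mZ; exact: measurable_indic.
Qed.

Lemma lam_weighted i f : Rintegrable mu D f ->
  Rintegrable mu D (fun x => lam i x * f x).
Proof. by apply: Rintegrable_weight => //; exact: measurable_funTS. Qed.

Lemma mixture_weighted j k f : Rintegrable mu D f ->
  Rintegrable mu D (fun x => mixture_weight j k x * f x).
Proof.
apply: Rintegrable_weight => //; first exact: measurable_mixture_weight.
by move=> x /mixture_weight01.
Qed.

Lemma Rintegrable_lam i : Rintegrable mu D (lam i).
Proof.
apply: (eq_Rintegrable mD (f := fun x => lam i x * 1)).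
  by move=> x _; rewrite mulr1.
exact/lam_weighted/Rintegrable_cst.
Qed.

Lemma Rintegrable_mixture_weight j k : Rintegrable mu D (mixture_weight j k).
Proof.
apply: (eq_Rintegrable mD (f := fun x => mixture_weight j k x * 1)).
  by move=> x _; rewrite mulr1.
exact/mixture_weighted/Rintegrable_cst.
Qed.

Lemma Rintegral_sum_mixture k f : Rintegrable mu D f ->
  \sum_j \int[mu]_(x in D) (mixture_weight j k x * f x) =
  \sum_(i in C k) \int[mu]_(x in D) (lam i x * f x).
Proof.
move=> fi; rewrite -!Rintegral_sum//.
- apply: eq_Rintegral => x; rewrite inE => Dx.
  by rewrite -!mulr_suml sum_mixture_weight.
- by move=> i _; exact: lam_weighted.
- by move=> j _; exact: mixture_weighted.
Qed.

Lemma Rintegral_mixture f : Rintegrable mu D f ->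
  \sum_k \sum_j \int[mu]_(x in D) (mixture_weight j k x * f x) =
  \int[mu]_(x in D) f x.
Proof.
move=> fi; under eq_bigr => k _ do rewrite (Rintegral_sum_mixture k fi).
rewrite sum_over_clusters// -Rintegral_sum//; last by move=> i _; exact: lam_weighted.
by apply: eq_Rintegral => x; rewrite inE => Dx; rewrite -mulr_suml lam_sum// mul1r.
Qed.

Definition mixture_mass j k : R := \int[mu]_(x in D) mixture_weight j k x.

Lemma mixture_mass_ge0 j k : 0 <= mixture_mass j k.
Proof. by apply: Rintegral_ge0 => x /mixture_weight_ge0. Qed.

Lemma sum_mixture_mass k : \sum_j mixture_mass j k = weight R C k.
Proof.
have := @Rintegral_sum_mixture k (fun=> 1) (Rintegrable_cst mD 1 muD).
under eq_bigr do under eq_Rintegral do rewrite mulr1.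
move=> ->; under eq_bigr do under eq_Rintegral do rewrite mulr1.
rewrite (eq_bigr (fun=> N%:R^-1)); last by move=> i _; exact: lam_mass.
by rewrite sumr_const -[LHS]mulr_natl.
Qed.

Lemma mixture_mass_Gamma : Gamma (weight R C) mixture_mass.
Proof. by split => [k|j k]; [exact: sum_mixture_mass|exact: mixture_mass_ge0]. Qed.

Section moments.
Variables (q : nat) (s : R).
Hypothesis s0 : 0 < s.
Let dist i x : R := nrm ((Z x : 'rV[R]_m) - sample pts i) ^+ q.+1.
Hypothesis cost_integrable : forall i, Rintegrable mu D (fun x => lam i x * dist i x).
Hypothesis cost_le : \sum_i \int[mu]_(x in D) (lam i x * dist i x) <= s ^+ q.+1.

(** The distance to [c] is at most the distance to a data point plus a constant;
    the $L^{q+1}$ triangle inequality with [s = t = 1] then gives a bound by the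
    integrable transport costs. *)
Lemma Rintegrable_nrm_pow (c : 'rV[R]_m) :
  Rintegrable mu D (fun x => nrm ((Z x : 'rV[R]_m) - c) ^+ q.+1).
Proof.
apply: (@le_Rintegrable _ _ _ _ _ mD _ (fun x => \sum_i (2 ^+ q * (lam i x * dist i x)
    + 2 ^+ q * nrm (sample pts i - c) ^+ q.+1 * lam i x))).
- apply: (@measurable_continuous_Z (fun u => nrm (u - c) ^+ q.+1)).
  exact: continuous_nrm_pow.
- move=> x Dx; rewrite ger0_norm ?exprn_ge0 ?nrm_ge0//.
  rewrite -[leLHS]mul1r -[X in X * _ <= _](lam_sum Dx) mulr_suml; apply: ler_sum => i _.
  rewrite [leRHS](_ : _ = lam i x * (2 ^+ q * ((1 ^+ q)^-1 * dist i x +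
      (1 ^+ q)^-1 * nrm (sample pts i - c) ^+ q.+1))); last first.
    by rewrite expr1n invr1; ring.
  apply: ler_wpM2l => //.
  apply: le_trans (exprSn_minkowski q (nrm_ge0 hnrm _) (nrm_ge0 hnrm _) ltr01 ltr01).
  apply: lerXn2r; rewrite ?nnegrE ?addr_ge0 ?nrm_ge0//.
  by apply: le_trans (nrmD hnrm _ _); rewrite addrA subrK.
- apply: Rintegrable_sum => // i _; apply: RintegrableD => //.
    exact: RintegrableZ.
  exact/RintegrableZ/Rintegrable_lam.
Qed.

Lemma Rintegrable_coord i : Rintegrable mu D (fun x => (Z x : 'rV[R]_m) ord0 i).
Proof.
have [c c0 hc] := norm_le_nrm hnrm.
apply: (@le_Rintegrable _ _ _ _ _ mD _
    (fun x => c * (1 + nrm ((Z x : 'rV[R]_m) - 0) ^+ q.+1))).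
- apply: (@measurable_continuous_Z (fun u => u ord0 i)).
  exact: coord_continuous.
- move=> x _; rewrite (le_trans (coord_le_norm _ _))// (le_trans (hc _))//.
  apply: ler_wpM2l; first exact: ltW.
  rewrite subr0; set y := nrm _; have y0 : 0 <= y by exact: nrm_ge0.
  have [y1|/ltW y1] := leP y 1; first by rewrite (le_trans y1)// lerDl exprn_ge0.
  by rewrite -[leLHS]add0r lerD ?ler01// -[leLHS]expr1 ler_weXn2l.
- apply: RintegrableZ => //; apply: RintegrableD => //; first exact: Rintegrable_cst.
  exact: Rintegrable_nrm_pow.
Qed.

Variables (i0 : 'I_N).

(** The default value [sample pts i0] is a point of [S]; it is taken only where
    the mass is zero. *)
Definition mixture_point j k : 'rV[R]_m :=
  barycenter_or mu D (sample pts i0) (mixture_weight j k) Z.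

Lemma mixture_coord_integrable j k i :
  Rintegrable mu D (fun x => mixture_weight j k x * (Z x : 'rV[R]_m) ord0 i).
Proof. exact/mixture_weighted/Rintegrable_coord. Qed.

Lemma mixture_point_in (S : set 'rV[R]_m) j k :
  closed S -> convex_in S -> S (sample pts i0) -> (forall x, D x -> S (Z x)) ->
  S (mixture_point j k).
Proof.
move=> clS cvS Si0 SZ; apply: barycenter_or_in => //.
- by move=> x /mixture_weight_ge0.
- exact: Rintegrable_mixture_weight.
- exact: mixture_coord_integrable.
- by move=> x /SZ.
Qed.

Lemma mixture_jensen j k (h : 'rV[R]_m -> \bar R) (H : T -> R) (y : R) :
  lower_semicontinuous h -> econvex_fun h -> Rintegrable mu D H ->
  (forall x, D x -> mixture_weight j k x != 0 -> (h (Z x) <= (H x)%:E)%E) ->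
  h (mixture_point j k) = y%:E ->
  mixture_mass j k * y <= \int[mu]_(x in D) (mixture_weight j k x * H x).
Proof.
move=> lsc cvx Hi hZ hy; apply: weighted_jensen hy => //.
- by move=> x /mixture_weight_ge0.
- exact: Rintegrable_mixture_weight.
- exact: mixture_coord_integrable.
- exact/measurable_EFinP/(measurable_int mu).
- exact: mixture_weighted.
Qed.

Lemma mixture_jensen_nrm j k c :
  mixture_mass j k * nrm (mixture_point j k - c) ^+ q.+1 <=
  \int[mu]_(x in D) (mixture_weight j k x * nrm ((Z x : 'rV[R]_m) - c) ^+ q.+1).
Proof.
apply: (@mixture_jensen j k (nrm_pow (nrm := nrm) c q.+1)) => //.
- apply: (continuous_lsc (f := fun u : 'rV[R]_m => nrm (u - c) ^+ q.+1)).
  exact: continuous_nrm_pow.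
- exact: econvex_nrm_pow.
- exact: Rintegrable_nrm_pow.
Qed.

(** The triangle inequality in $L^{q+1}$: moving the mass from the data points
    costs at most [s], moving the data points to their centroids at most [t]. *)
Lemma mixture_cost_finite (c : 'I_K -> 'rV[R]_m) (t : R) : 0 < t ->
  N%:R^-1 * (\sum_k \sum_(i in C k) nrm (sample pts i - c k) ^+ q.+1) <= t ^+ q.+1 ->
  \sum_k \sum_j mixture_mass j k * nrm (mixture_point j k - c k) ^+ q.+1
  <= (s + t) ^+ q.+1.
Proof.
move=> t0 ht.
have step k i : \int[mu]_(x in D) (lam i x * nrm ((Z x : 'rV[R]_m) - c k) ^+ q.+1) <=
  (s + t) ^+ q * ((s ^+ q)^-1 * (\int[mu]_(x in D) (lam i x * dist i x)) +
     (t ^+ q)^-1 * (N%:R^-1 * nrm (sample pts i - c k) ^+ q.+1)).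
  pose B := (t ^+ q)^-1 * nrm (sample pts i - c k) ^+ q.+1.
  have -> : (s + t) ^+ q * ((s ^+ q)^-1 * (\int[mu]_(x in D) (lam i x * dist i x)) +
     (t ^+ q)^-1 * (N%:R^-1 * nrm (sample pts i - c k) ^+ q.+1)) =
     \int[mu]_(x in D) ((s + t) ^+ q * (s ^+ q)^-1 * (lam i x * dist i x) +
        (s + t) ^+ q * B * lam i x).
    rewrite RintegralD//; [|exact: RintegrableZ|exact/RintegrableZ/Rintegrable_lam].
    rewrite !RintegralZl//; [|exact: Rintegrable_lam|exact: cost_integrable].
    by rewrite lam_mass /B; ring.
  apply: le_Rintegral => //.
  - exact/lam_weighted/Rintegrable_nrm_pow.
  - by apply: RintegrableD => //; apply: RintegrableZ => //; exact: Rintegrable_lam.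
  - move=> x Dx.
    rewrite [leRHS](_ : _ = lam i x * ((s + t) ^+ q * ((s ^+ q)^-1 * dist i x +
      (t ^+ q)^-1 * nrm (sample pts i - c k) ^+ q.+1))); last by rewrite /B; ring.
    apply: ler_wpM2l => //.
    apply: le_trans (exprSn_minkowski q (nrm_ge0 hnrm _) (nrm_ge0 hnrm _) s0 t0).
    apply: lerXn2r; rewrite ?nnegrE ?addr_ge0 ?nrm_ge0//.
    by apply: le_trans (nrmD hnrm _ _); rewrite addrA subrK.
apply: (@le_trans _ _ (\sum_k \sum_(i in C k) ((s + t) ^+ q *
     ((s ^+ q)^-1 * (\int[mu]_(x in D) (lam i x * dist i x)) +
     (t ^+ q)^-1 * (N%:R^-1 * nrm (sample pts i - c k) ^+ q.+1))))).
  apply: ler_sum => k _.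
  apply: (@le_trans _ _ (\sum_j \int[mu]_(x in D)
      (mixture_weight j k x * nrm ((Z x : 'rV[R]_m) - c k) ^+ q.+1))).
    by apply: ler_sum => j _; exact: mixture_jensen_nrm.
  rewrite Rintegral_sum_mixture; last exact: Rintegrable_nrm_pow.
  by apply: ler_sum => i _.
under eq_bigr do rewrite -mulr_sumr big_split /= -!mulr_sumr.
rewrite -mulr_sumr big_split /= -!mulr_sumr sum_over_clusters//.
rewrite exprSr; apply: ler_wpM2l; first by rewrite exprn_ge0// ltW// addr_gt0.
have pow_div (r : R) : 0 < r -> r = (r ^+ q)^-1 * r ^+ q.+1.
  by move=> r0; rewrite exprS mulrCA mulVf ?mulr1// expf_neq0// gt_eqF.
rewrite [in leRHS](pow_div s)// [X in _ <= _ + X](pow_div t)//.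
by apply: lerD; apply: ler_wpM2l => //; rewrite invr_ge0 exprn_ge0// ltW.
Qed.

(** Jensen's inequality for the power [q.+1] of the norm bounds the distance
    itself, because the integrand is at most [(s + t) ^+ q.+1] everywhere. *)
Lemma mixture_cost_infinite (k : 'I_K) (c : 'rV[R]_m) (t : R) : 0 <= t ->
  (0 < N)%N ->
  (forall i x, D x -> lam i x != 0 -> nrm ((Z x : 'rV[R]_m) - sample pts i) <= s) ->
  (forall i, i \in C k -> nrm (sample pts i - c) <= t) ->
  \sum_j mixture_mass j k / weight R C k * nrm (mixture_point j k - c) <= s + t.
Proof.
move=> t0 N0 hs ht; have st0 : 0 <= s + t by rewrite addr_ge0// ltW.
have w0 : 0 < weight R C k.
  have [+ _ _] := hC => /(_ k)[i ik].
  by rewrite divr_gt0// ltr0n// card_gt0; apply/set0Pn; exists i.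
have step j : mixture_mass j k * nrm (mixture_point j k - c) <= mixture_mass j k * (s + t).
  (* without mass, [mixture_point] is an arbitrary data point, at no cost *)
  have [->|a0] := eqVneq (mixture_mass j k) 0; first by rewrite !mul0r.
  have {}a0 : 0 < mixture_mass j k by rewrite lt_neqAle eq_sym a0 mixture_mass_ge0.
  rewrite ler_pM2l// -(@ler_pXn2r _ q.+1)// ?nnegrE ?nrm_ge0//.
  rewrite -(ler_pM2l a0); apply: le_trans (mixture_jensen_nrm j k c) _.
  rewrite mulrC -RintegralZl//; last exact: Rintegrable_mixture_weight.
  apply: le_Rintegral => //.
  - exact/mixture_weighted/Rintegrable_nrm_pow.
  - exact/RintegrableZ/Rintegrable_mixture_weight.
  - move=> x Dx; rewrite mulrC; have [->|w] := eqVneq (mixture_weight j k x) 0.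
      by rewrite !mulr0.
    apply: ler_wpM2r; first exact: mixture_weight_ge0.
    have [_ [i ik li]] := mixture_weight_neq0 w.
    apply: lerXn2r; rewrite ?nnegrE ?nrm_ge0//.
    rewrite -(subrK (sample pts i) (Z x : 'rV[R]_m)) -addrA.
    by rewrite (le_trans (nrmD hnrm _ _))// lerD ?hs ?ht.
rewrite (eq_bigr (fun j => (weight R C k)^-1 *
    (mixture_mass j k * nrm (mixture_point j k - c)))); last first.
  by move=> j _; ring.
rewrite -mulr_sumr ler_pdivrMl// -sum_mixture_mass mulr_suml.
by apply: ler_sum.
Qed.

(** Jensen's inequality for the concave functions [gx j], each on the part of
    the space where it is the maximal one. *)
Lemma mixture_value (gx : 'I_J -> 'rV[R]_m -> \bar R) (G : T -> R) :
  (forall j, lower_semicontinuous (fun u => - gx j u)%E) ->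
  (forall j, econvex_fun (fun u => - gx j u)%E) ->
  Rintegrable mu D G ->
  (forall j x, D x -> cell j (Z x) -> gx j (Z x) = (G x)%:E) ->
  (forall j k, gx j (mixture_point j k) \is a fin_num) ->
  \int[mu]_(x in D) G x <=
    \sum_k \sum_j mixture_mass j k * fine (gx j (mixture_point j k)).
Proof.
move=> lsc cvx Gi gG gfin; rewrite -Rintegral_mixture//.
apply: ler_sum => k _; apply: ler_sum => j _.
have NGi : Rintegrable mu D (fun x => - 1 * G x) by exact: RintegrableZ.
have := @mixture_jensen j k _ _ (- fine (gx j (mixture_point j k)))
  (lsc j) (cvx j) NGi.
rewrite EFinN fineK// => /(_ _ erefl) h; rewrite -lerN2 -mulrN.
apply: le_trans (h _) _.
  by move=> x Dx /mixture_weight_neq0[cx _]; rewrite (gG _ _ Dx cx) mulN1r EFinN.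
rewrite -[leRHS]mulN1r -RintegralZl//; last exact: mixture_weighted.
rewrite le_eqVlt; apply/orP; left; apply/eqP.
by apply: eq_Rintegral => x _; ring.
Qed.

End moments.
End mixture.

(** * Transfer of integrals along a marginal *)

Section integral_transfer.
Context {R : realType}.

(** A function with an integrable upper bound is either integrable or of integral
    [-oo]. *)
Lemma integral_le0_dichotomy d (T : measurableType d) (mu : {measure set T -> \bar R})
    (D : set T) (f A : T -> R) : measurable D ->
  measurable_fun D f -> Rintegrable mu D A -> (forall x, D x -> f x <= A x) ->
  (Rintegrable mu D f -> \int[mu]_(x in D) f x <= 0) ->
  (\int[mu]_(x in D) (f x)%:E <= 0)%E.
Proof.
move=> mD mf Ai fA hf; have [fi|nfi] := pselect (Rintegrable mu D f).
  have := hf fi; rewrite /Rintegral -lee_fin fineK//; exact: integrable_fin_num.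
pose F : T -> \bar R := EFin \o f.
have mF : measurable_fun D F by exact/measurable_EFinP.
have posfin : (\int[mu]_(x in D) F^\+%E x < +oo)%E.
  have /integrableP[mA] := Ai; apply: le_lt_trans; apply: ge0_le_integral => //.
  - exact: measurable_funepos.
  - exact: measurableT_comp.
  - move=> x Dx; rewrite funeposE /F /= ge_max !lee_fin normr_ge0 andbT.
    by rewrite (le_trans (fA _ Dx))// ler_norm.
have negy : (\int[mu]_(x in D) F^\-%E x = +oo)%E.
  apply/eqP; rewrite -leye_eq leNgt; apply/negP => negfin; apply: nfi.
  apply/integrableP; split => //; rewrite -/F.
  rewrite (eq_integral (fun x => F^\+%E x + F^\-%E x)%E); last first.
    by move=> x _; rewrite -[LHS]/((abse \o F) x) fune_abse.
  rewrite ge0_integralD//; last 2 first.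
  - exact: measurable_funepos.
  - exact: measurable_funeneg.
  by rewrite lte_add_pinfty.
rewrite -[leLHS]/(\int[mu]_(x in D) F x)%E integralE negy.
by move: posfin; set I := (\int[mu]_(x in D) _)%E; case: I => [r| |] //= _; rewrite leNye.
Qed.

(** The positive and the negative part are transferred separately, which covers
    the functions of integral [-oo]. *)
Lemma integral_marginal d d' (T : measurableType d) (U : measurableType d')
    (P : probability U R) (Pi : probability T R) (D : set T) (X : T -> U)
    (f : U -> \bar R) : measurable_fun setT X ->
  (forall A, measurable A -> Pi (X @^-1` A) = P A) ->
  measurable D -> Pi D = 1%E -> measurable_fun setT f ->
  (\int[P]_u f u = \int[Pi]_(z in D) f (X z))%E.
Proof.
move=> mX marg mD D1 mf.
have ge0 (h : U -> \bar R) : measurable_fun setT h -> (forall u, 0 <= h u)%E ->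
    (\int[P]_u h u = \int[Pi]_(z in D) h (X z))%E.
  move=> mh h0; pose PiX := pushforward Pi X.
  rewrite (@eq_measure_integral _ _ _ setT [the measure _ _ of PiX]); last first.
    by move=> A mA _; exact/esym/marg.
  rewrite ge0_integral_pushforward//.
  have D0 : Pi (~` D) = 0%E by rewrite probability_setC// D1 subee.
  have mhX : measurable_fun setT (h \o X) by exact: measurableT_comp.
  have mDC : measurable (~` D) by exact: measurableC.
  rewrite preimage_setT (ge0_negligible_integral mDC measurableT mhX)//.
    by rewrite setTD setCK.
  by move=> x _; exact: h0.
rewrite integralE [RHS]integralE (ge0 _ (measurable_funepos mf))//.
rewrite (ge0 _ (measurable_funeneg mf))//; congr (_ - _)%E.
  by apply: eq_integral => z _; rewrite !funeposE.
by apply: eq_integral => z _; rewrite !funenegE.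
Qed.

End integral_transfer.

(** * Weights of the data points and clustering error *)

Section plan_weights.
Context {R : realType} {m : nat} {nrm : 'rV[R]_m -> R}.
Hypothesis hnrm : is_norm nrm.
Local Notation U := (borelRV R m).
Variables (N : nat) (d : N.-tuple U).
Variables (Pi : probability (U * U)%type R) (D : set (U * U)) (s : R).
Hypothesis mD : measurable D.
Hypothesis D_sample : forall z, D z -> exists i, z.2 = sample d i.
Hypothesis D_mass : forall i, Pi ((snd @^-1` [set sample d i]) `&` D) =
  (N%:R^-1 * multiplicity d i)%:E.

(** Equal data points share evenly the mass transported to their common
    location, so that each of them receives exactly [1 / N]. *)
Definition point_weight i (z : U * U) : R :=
  (multiplicity d i)^-1 * \1_[set sample d i] z.2.

Let mult_gt0 i : 0 < multiplicity d i.
Proof. exact: lt_le_trans ltr01 (multiplicity_ge1 d i). Qed.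

Lemma measurable_point_weight i : measurable_fun setT (point_weight i).
Proof.
apply: measurable_funM; first exact: measurable_cst.
apply: measurableT_comp measurable_snd; apply: measurable_indic.
exact: measurable_point.
Qed.

Lemma point_weight01 i z : 0 <= point_weight i z <= 1.
Proof.
rewrite /point_weight indicE; case: (_ \in _); rewrite ?mulr1 ?mulr0 ?lexx ?ler01//.
by rewrite invr_ge0 ltW//= invf_le1// multiplicity_ge1.
Qed.

Lemma point_weight_neq0 i z : point_weight i z != 0 -> z.2 = sample d i.
Proof.
rewrite /point_weight indicE => h; apply: contrapT => hz; move: h.
by rewrite memNset// mulr0 eqxx.
Qed.

Lemma sum_point_weight z : D z -> \sum_i point_weight i z = 1.
Proof.
move=> /D_sample[i0 zi0].
have E i : point_weight i z =
    (multiplicity d i0)^-1 * (sample d i == sample d i0)%:R.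
  rewrite /point_weight indicE zi0; have [e|ne] := eqVneq (sample d i) (sample d i0).
    by rewrite /multiplicity !e mem_set.
  by rewrite memNset ?mulr0// => /= e; rewrite e eqxx in ne.
under eq_bigr do rewrite E.
by rewrite -mulr_sumr mulVf// gt_eqF.
Qed.

Lemma point_weight_mass i : \int[Pi]_(z in D) point_weight i z = N%:R^-1.
Proof.
have mA : measurable ((snd : U * U -> U) @^-1` [set sample d i]).
  rewrite -[X in measurable X]setTI; apply: measurable_snd => //.
  exact: measurable_point.
rewrite /point_weight RintegralZl//; last first.
  apply: measurable_bounded_integrable => //.
  - by rewrite (le_lt_trans (probability_le1 Pi mD))// ltry.
  - apply: measurable_funTS; apply: measurableT_comp measurable_snd.
    by apply: measurable_indic; exact: measurable_point.
  - exists 1; split => // M M1 z _ /=; rewrite indicE.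
    by case: (_ \in _); rewrite ?normr1 ?normr0 ltW// (lt_trans _ M1).
have -> : \int[Pi]_(z in D) \1_[set sample d i] z.2 = N%:R^-1 * multiplicity d i.
  rewrite -[RHS]/(fine (_%:E)) -D_mass; congr fine.
  exact: (integral_indic Pi mD mA).
by rewrite mulrCA mulVf ?mulr1// gt_eqF.
Qed.

Let dist q i (z : U * U) : R := nrm ((z.1 : 'rV[R]_m) - sample d i) ^+ q.+1.

Lemma point_weight_dist q i z : point_weight i z * dist q i z =
  point_weight i z * nrm ((z.1 : 'rV[R]_m) - z.2) ^+ q.+1.
Proof.
have [->|/point_weight_neq0 e] := eqVneq (point_weight i z) 0; first by rewrite !mul0r.
by rewrite /dist -e.
Qed.

Lemma sum_point_weight_dist q z : D z ->
  \sum_i point_weight i z * dist q i z = nrm ((z.1 : 'rV[R]_m) - z.2) ^+ q.+1.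
Proof.
move=> Dz; under eq_bigr do rewrite point_weight_dist.
by rewrite -mulr_suml sum_point_weight// mul1r.
Qed.

Lemma measurable_point_cost q i :
  measurable_fun D (fun z => point_weight i z * dist q i z).
Proof.
apply: measurable_funTS; apply: measurable_funM; first exact: measurable_point_weight.
have /continuous_borel mf := @continuous_nrm_pow _ _ _ hnrm (sample d i) q.+1.
exact: (measurableT_comp mf measurable_fst).
Qed.

(** The weights vanish unless the second coordinate is the data point, so the
    costs to the individual data points add up to the cost of the plan. *)
Lemma finite_cost_integrable q :
  (\int[Pi]_(z in D) (nrm ((z.1 : 'rV[R]_m) - z.2) ^+ q.+1)%:E <= (s ^+ q.+1)%:E)%E ->
  (forall i, Rintegrable Pi D (fun z => point_weight i z * dist q i z)) /\
  \sum_i \int[Pi]_(z in D) (point_weight i z * dist q i z) <= s ^+ q.+1.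
Proof.
move=> hs; pose F z := \sum_i point_weight i z * dist q i z.
have pd0 i z : 0 <= point_weight i z * dist q i z.
  by rewrite mulr_ge0 ?exprn_ge0 ?nrm_ge0//; case/andP: (point_weight01 i z).
have F0 z : 0 <= F z by exact: sumr_ge0.
have FE : (\int[Pi]_(z in D) (F z)%:E <= (s ^+ q.+1)%:E)%E.
  rewrite (eq_integral (fun z : U * U => (nrm ((z.1 : 'rV[R]_m) - z.2) ^+ q.+1)%:E))//.
  by move=> z; rewrite inE => Dz; rewrite /F sum_point_weight_dist.
have Fi : Rintegrable Pi D F.
  apply/integrableP; split.
    by apply/measurable_EFinP/measurable_sum => i; exact: measurable_point_cost.
  rewrite (eq_integral (fun z => (F z)%:E)); last first.
    by move=> z _; rewrite /= ger0_norm.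
  by rewrite (le_lt_trans FE)// ltry.
have Pii i : Rintegrable Pi D (fun z => point_weight i z * dist q i z).
  apply: (le_Rintegrable mD _ _ Fi); first exact: measurable_point_cost.
  move=> z Dz; rewrite ger0_norm// /F (bigD1 i)//= lerDl.
  exact: sumr_ge0.
split => //; rewrite -Rintegral_sum// -lee_fin fineK//.
exact: integrable_fin_num.
Qed.

Lemma infinite_cost_integrable :
  (forall z, D z -> nrm ((z.1 : 'rV[R]_m) - z.2) <= s) ->
  forall i, Rintegrable Pi D (fun z => point_weight i z * dist 0 i z).
Proof.
move=> hs i.
have sfin : Rintegrable Pi D (fun=> s).
  by apply: Rintegrable_cst => //; rewrite (le_lt_trans (probability_le1 Pi mD))// ltry.
apply: (le_Rintegrable mD _ _ sfin); first exact: measurable_point_cost.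
move=> z Dz; rewrite point_weight_dist expr1.
have /andP[w0 w1] := point_weight01 i z.
have n0 := nrm_ge0 hnrm ((z.1 : 'rV[R]_m) - z.2).
rewrite ger0_norm; last exact: mulr_ge0.
rewrite -[leRHS]mul1r.
by apply: ler_pM => //; exact: hs.
Qed.

End plan_weights.

Section eta_bounds.
Context {R : realType} {m : nat} {nrm : 'rV[R]_m -> R}.
Hypothesis hnrm : is_norm nrm.
Variables (N K : nat) (d : N.-tuple (borelRV R m)) (C : 'I_K -> {set 'I_N}).

Lemma eta_ge0 q : 0 <= Defs.eta nrm d C q.
Proof.
rewrite mulr_ge0 ?invr_ge0// sumr_ge0// => k _; apply: sumr_ge0 => i _.
by rewrite exprn_ge0// nrm_ge0.
Qed.

Lemma eta_root_ge0 p : 0 <= eta_root nrm d C p.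
Proof.
case: p => [q|]; first exact: powR_ge0.
by rewrite /= bigmax_ge_id.
Qed.

Lemma eta_rootK q : (1 <= q)%N -> eta_root nrm d C (FiniteOrder q) ^+ q = Defs.eta nrm d C q.
Proof.
move=> q1; rewrite /= -powR_mulrn ?powR_ge0// -powRrM mulVf ?powRr1 ?eta_ge0//.
by rewrite pnatr_eq0 -lt0n.
Qed.

Lemma le_eta_root_infinite k i : i \in C k ->
  nrm (sample d i - centroid d C k) <= eta_root nrm d C InfiniteOrder.
Proof.
move=> ik; apply: (bigmax_sup k) => //.
by apply: (bigmax_sup i).
Qed.

End eta_bounds.

(** * Feasible decisions under a small Wasserstein distance *)

Section feasible_decisions.
Context {R : realType} {m n J : nat}.
Variables (hJ : (1 <= J)%N) (X : set 'rV[R]_n) (S : set 'rV[R]_m).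
Hypothesis hSconvex : convex_set (S : set (convex_lmodType 'rV[R]_m)).
Hypothesis hSclosed : closed S.
Variables (nrm : 'rV[R]_m -> R) (g : 'I_J -> 'rV[R]_m -> 'rV[R]_n -> \bar R).
Hypotheses (hnrm : is_norm nrm) (hg : constraint_condition X S g).
Local Notation U := (borelRV R m).

Lemma convex_set_in : convex_in S.
Proof.
move=> t x y t01 Sx Sy; have /andP[t0 t1] := t01.
pose l : {i01 R} := Itv01 t0 t1.
have := @hSconvex x y l; rewrite !inE => /(_ Sx Sy).
by [].
Qed.

Section decision.
Variable x : 'rV[R]_n.
Hypothesis Xx : X x.

Lemma constraint_fin_num j u : S u -> g j u x \is a fin_num.
Proof.
have [/(_ _ Xx)[[gpos _] _ _] [Dom [domE SD _]]] := hg j => Su.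
rewrite fin_numElt; apply/andP; split.
  by have : dom_u (g j) x u by rewrite (domE _ Xx); exact: SD.
by have := gpos u; rewrite lteNr.
Qed.

Lemma measurable_constraint j : measurable_fun setT (fun u : U => g j u x).
Proof.
have [/(_ _ Xx)[_ _ lsc] _] := hg j.
have := measurableT_comp (@oppe_measurable R setT) (lsc_measurable lsc).
by apply: eq_measurable_fun => u _ /=; rewrite oppeK.
Qed.

Lemma gmax_fin_num u : S u -> gmax g u x \is a fin_num.
Proof.
move=> Su; have [j [Fj _]] := @argmax_cell_attained _ U R J (fun j u => g j u x) u hJ.
rewrite (_ : gmax g u x = g j u x); last exact/esym/Fj.
exact: constraint_fin_num.
Qed.

Lemma gmax_le_affine : exists (c : 'I_J -> R) (a : 'I_J -> 'rV[R]_m),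
  forall u, (gmax g u x <= (\sum_j `|c j + dotp (a j) u|)%:E)%E.
Proof.
have /choice[ca hca] : forall j, exists ca : R * 'rV[R]_m,
    forall u, ((ca.1 + dotp ca.2 u)%:E <= - g j u x)%E.
  move=> j; have [/(_ _ Xx)[prop cvx lsc] _] := hg j.
  by have [c [a ha]] := affine_minorant prop cvx lsc; exists (c, a).
exists (fun j => (ca j).1), (fun j => (ca j).2) => u.
apply: bigmax_le => [|j _]; first exact: leNye.
apply: (@le_trans _ _ (`|(ca j).1 + dotp (ca j).2 u|)%:E).
  rewrite -leeN2; apply: le_trans (hca j u).
  by rewrite -EFinN lee_fin lerNl -normrN ler_norm.
by rewrite lee_fin (bigD1 j)//= lerDl sumr_ge0.
Qed.

End decision.

(** The deterministic part of the guarantee: the reweighted barycenters built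
    from a transport plan are an admissible perturbation of the centroids. *)
Lemma mean_le0_of_wasserstein_lt (P : probability U R) (p : worder) (N K : nat)
    (d : N.-tuple U) (C : 'I_K -> {set 'I_N}) (epsN : R) (x : 'rV[R]_n) :
  P S = 1%E -> worder_ge1 p -> (0 < N)%N -> 0 < epsN ->
  (forall i, S (tnth d i)) -> is_clustering C ->
  mro_feasible nrm X S g p (weight R C) (centroid d C)
    (epsN + eta_root nrm d C p) x ->
  (wasserstein nrm p P (empirical d) < epsN%:E)%E ->
  (\int[P]_u gmax g u x <= 0)%E.
Proof.
move=> PS p1 N0 e0 Sd hC [Xx feas] Wlt.
have [Pi [D [s [marg [mD D1] [DS Dsample Dmass] /andP[s0 se] cost]]]] :=
  transport_plan hnrm N0 hSclosed PS p1 e0 Wlt.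
pose i0 := Ordinal N0.
pose F j (u : U) := g j u x.
have mF j : measurable_fun setT (F j) by exact: measurable_constraint.
pose cell := argmax_cell F.
have mcell j : measurable (cell j) by exact: measurable_argmax_cell.
have cellS (z : U * U) : D z -> \sum_j \1_(cell j) z.1 = 1 :> R.
  by move=> _; exact: argmax_cell_sum.
pose lam := point_weight d.
have mlam i : measurable_fun setT (lam i) by exact: measurable_point_weight.
have lam01 i z : 0 <= lam i z <= 1 by exact: point_weight01.
have lamS z : D z -> \sum_i lam i z = 1 by exact: sum_point_weight.
have lamM i : \int[Pi]_(z in D) lam i z = N%:R^-1 by exact: point_weight_mass.
pose alpha := mixture_mass Pi D fst lam C cell.
pose v := mixture_point Pi D fst d lam C cell i0.
have t0 : 0 <= eta_root nrm d C p by exact: eta_root_ge0.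
have [q [costi unc]] : exists q, (forall i, Rintegrable Pi D
      (fun z : U * U => lam i z * nrm ((z.1 : 'rV[R]_m) - sample d i) ^+ q.+1)) /\
    ((forall j k, S (v j k)) ->
     uncertainty_set nrm S p (weight R C) (centroid d C) (epsN + eta_root nrm d C p)
     alpha v).
  (* the exponents are written as successors; [q = 0] serves the infinite order,
     where the distance is bounded and its first power suffices *)
  case: p p1 {Wlt feas} cost t0 => [[//|q] _|_] cost t0.
    have [costi costle] := finite_cost_integrable hnrm mD Dsample cost.
    exists q; split => // Sv; split => //.
    (* the slack [epsN - s] makes the second radius positive even when every data
       point is its own centroid *)
    have t'0 : 0 < epsN - s + eta_root nrm d C (FiniteOrder q.+1).
      by rewrite ltr_wpDr// subr_gt0.
    have := @mixture_cost_finite _ _ _ Pi D m N K J mD nrm fst d lam C cell hnrm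
      measurable_fst mlam lam01 lamS lamM hC mcell cellS q s s0 costi costle i0
      (centroid d C) _ t'0.
    rewrite addrA (addrC s) subrK; apply.
    rewrite -[leLHS]/(Defs.eta nrm d C q.+1) -(eta_rootK hnrm)//.
    apply: lerXn2r; rewrite ?nnegrE ?(ltW t'0)//.
    by rewrite lerDr subr_ge0 ltW.
  have costi := infinite_cost_integrable hnrm d Pi mD cost.
  exists 0%N; split => // Sv; split => //.
  apply: bigmax_le => [|k _]; first by rewrite addr_ge0// ltW.
  apply: (@le_trans _ _ (s + eta_root nrm d C InfiniteOrder)); last by rewrite lerD2r ltW.
  apply: (@mixture_cost_infinite _ _ _ Pi D m N K J mD nrm fst d lam C cell hnrm
      measurable_fst mlam lam01 lamS lamM hC mcell cellS 0 s s0 costi) => //.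
    by move=> i z Dz /point_weight_neq0 <-; exact: cost.
  by move=> i; exact: le_eta_root_infinite.
have Sv j k : S (v j k).
  apply: (@mixture_point_in _ _ _ Pi D m N K J mD nrm fst d lam C cell hnrm
    measurable_fst mlam lam01 lamS hC mcell q costi) => //.
  - exact: convex_set_in.
  - exact: Sd.
have alphaG : Gamma (weight R C) alpha.
  exact: (@mixture_mass_Gamma _ _ _ Pi D m N K J mD fst lam C cell
    measurable_fst mlam lam01 lamS lamM hC mcell cellS).
have {feas} := feas _ _ alphaG (unc Sv).
have vfin j k : g j (v j k) x \is a fin_num by exact: constraint_fin_num.
rewrite (_ : (\sum_k \sum_j _)%E =
    (\sum_k \sum_j alpha j k * fine (g j (v j k) x))%:E); last first.
  rewrite -sumEFin; apply: eq_bigr => k _; rewrite -sumEFin; apply: eq_bigr => j _.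
  by rewrite EFinM (fineK (vfin j k)).
rewrite lee_fin => feas.
pose M (u : U) := gmax g u x.
have mM : measurable_fun setT M by exact: measurable_maxfun.
rewrite (integral_marginal measurable_fst marg mD D1 mM).
pose G (z : U * U) := fine (M z.1).
have MG z : D z -> M z.1 = (G z)%:E.
  by move=> /DS Sz; rewrite /G fineK//; exact: gmax_fin_num.
rewrite (eq_integral (fun z => (G z)%:E)); last by move=> z; rewrite inE => /MG.
have [c [a hca]] := gmax_le_affine Xx.
apply: (@integral_le0_dichotomy _ _ _ Pi D G
  (fun z => \sum_j `|c j + dotp (a j) (z.1 : 'rV[R]_m)|)) => //.
- apply: measurable_funTS; apply: measurableT_comp => //.
  exact: measurableT_comp mM measurable_fst.
- apply: Rintegrable_sum => // j _; apply: integrable_norm => //.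
  apply: RintegrableD => //.
    by apply: Rintegrable_cst => //; rewrite (le_lt_trans (probability_le1 Pi mD))// ltry.
  apply: Rintegrable_sum => // i _; apply: RintegrableZ => //.
  exact: (@Rintegrable_coord _ _ _ Pi D m N mD nrm fst d lam hnrm
    measurable_fst mlam lam01 lamS q costi i).
- by move=> z Dz; rewrite -lee_fin -MG//; exact: hca.
- move=> Gi; apply: le_trans feas.
  apply: (@mixture_value _ _ _ Pi D m N K J mD nrm fst d lam C cell hnrm
    measurable_fst mlam lam01 lamS hC mcell cellS q costi i0
    (fun j u => g j u x) G) => //.
  + by move=> j; have [/(_ _ Xx)[]] := hg j.
  + by move=> j; have [/(_ _ Xx)[]] := hg j.
  + by move=> j z Dz [Fj _]; rewrite -MG// -Fj.
Qed.

End feasible_decisions.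

(** * Inner and outer probabilities of the sample *)

Section sampling.
Context d (T : measurableType d) (R : realType) (P : probability T R).

Lemma measurable_box N (A : set T) : measurable A ->
  measurable [set s : N.-tuple T | forall i, A (tnth s i)].
Proof.
move=> mA; rewrite (_ : mkset _ = \big[setI/setT]_(i < N)
    ((fun s : N.-tuple T => tnth s i) @^-1` A)).
  apply: bigsetI_measurable => i _.
  by rewrite -[_ @^-1` _]setTI; exact: measurable_tnth.
rewrite -bigcap_seq; apply/seteqP; split => [s h i _|s h i]; first exact: h.
by apply: h; rewrite /= mem_index_enum.
Qed.

Lemma prob_power_support N (A : set T) : measurable A -> P A = 1%E ->
  prob_power P N [set s | forall i, A (tnth s i)] = 1%E.
Proof.
by move=> mA PA; rewrite (prob_power_box P (A := fun=> A))// big1.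
Qed.

Lemma outer_prob_lt (B : set T) (y : \bar R) : (outer_prob P B < y)%E ->
  exists C, [/\ measurable C, B `<=` C & (P C < y)%E].
Proof. by move=> /ereal_inf_lt[_ [C [mC BC] <-] Cy]; exists C. Qed.

Lemma inner_prob_ge (B C : set T) : measurable C -> C `<=` B ->
  (P C <= inner_prob P B)%E.
Proof. by move=> mC CB; apply: ereal_sup_ubound; exists C. Qed.

(** The exceptional event may be covered by a measurable one of almost the same
    probability, whose complement, cut by the almost sure event, is measurable. *)
Lemma inner_prob_ge_onem (B A E : set T) (b : R) : measurable A -> P A = 1%E ->
  (outer_prob P B <= b%:E)%E -> A `\` B `<=` E ->
  ((1 - b)%:E <= inner_prob P E)%E.
Proof.
move=> mA PA hB ABE; apply/lee_addgt0Pr => e e0.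
have [|C [mC BC PC]] := @outer_prob_lt B (b + e)%:E.
  by rewrite (le_lt_trans hB)// lte_fin ltrDl.
have mCA : measurable (~` C `&` A) by apply: measurableI => //; exact: measurableC.
have CAE : ~` C `&` A `<=` E.
  by move=> x [Cx Ax]; apply: ABE; split => // Bx; exact/Cx/BC.
have := inner_prob_ge mCA CAE.
rewrite measureI_full//; last exact: measurableC.
rewrite probability_setC// => h; rewrite -leeBlDr//.
apply: le_trans h; rewrite -EFinB leeBrDr; last exact: fin_num_measure.
move: PC; rewrite -(fineK (fin_num_measure P C mC)) lte_fin => PC.
by rewrite -EFinD lee_fin; lra.
Qed.

End sampling.

(** * The finite sample guarantee *)

Theorem theorem3p3 (R : realType) (m n J : nat) (hJ : (1 <= J)%N)
  (X : set 'rV[R]_n) (hX : compact X)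
  (f : 'rV[R]_n -> R)
  (S : set 'rV[R]_m) (hSconvex : convex_set (S : set (convex_lmodType 'rV[R]_m)))
  (hSclosed : closed S)
  (nrm : 'rV[R]_m -> R) (hnrm : is_norm nrm)
  (g : 'I_J -> 'rV[R]_m -> 'rV[R]_n -> \bar R)
  (hg : constraint_condition X S g)
  (P : probability (borelRV R m) R) (hPS : P S = 1%E)
  (p : worder) (hp : worder_ge1 p)
  (hP : match p with
        | FiniteOrder _ => light_tailed nrm P
        | InfiniteOrder => regular S P
        end)
  (phi : worder -> nat -> R -> R) (hphi : concentration_bound nrm p P phi)
  (N K : nat) (hN : (0 < N)%N)
  (beta : R) (hbeta : 0 < beta < 1)
  (epsN : R) (hepsN : 0 < epsN) (hphi_epsN : phi p N epsN = beta)
  (C : N.-tuple (borelRV R m) -> 'I_K -> {set 'I_N})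
  (hC : forall d : N.-tuple (borelRV R m), (forall i, S (tnth d i)) -> is_clustering (C d))
  (xhat : N.-tuple (borelRV R m) -> 'rV[R]_n)
  (hxhat : forall d : N.-tuple (borelRV R m), (forall i, S (tnth d i)) ->
     mro_optimal nrm X S f g p (weight R (C d)) (centroid d (C d))
       (epsN + eta_root nrm d (C d) p) (xhat d)) :
  ((1 - beta)%:E <=
     inner_prob (prob_power P N)
       [set d | \int[P]_u gmax g u (xhat d) <= 0])%E.
Proof.
have mS : measurable (S : set (borelRV R m)) by exact: closed_borel.
pose far := [set d : N.-tuple (borelRV R m) | (epsN%:E <= wasserstein nrm p P (empirical d))%E].
pose inS := [set d : N.-tuple (borelRV R m) | forall i, S (tnth d i)].
have mass_inS : prob_power P N inS = 1%E by exact: prob_power_support.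
have far_le : (outer_prob (prob_power P N) far <= beta%:E)%E.
  by rewrite -hphi_epsN; have [tail _] := hphi; exact: tail.
apply: (inner_prob_ge_onem (measurable_box mS) mass_inS far_le) => d [Sd /negP].
rewrite -ltNge => near_d; have [feas _] := hxhat d Sd.
exact: (mean_le0_of_wasserstein_lt hJ hSconvex hSclosed hnrm hg hPS hp hN hepsN
  Sd (hC d Sd) feas near_d).
Qed.
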